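(* Let $(M,g)$ be a Riemannian manifold and let $T^1_1(M)$ be equipped with the rescaled Sasaki type metric ${}^{S}g_f$. Then the Levi-Civita connection $\widetilde\nabla$ of ${}^Sg_f$ satisfies, with respect to the adapted frame, $$\begin{aligned} i)\ &\widetilde\nabla_{E_l}E_j=\Big\{\Gamma_{lj}^r+\tfrac1{2f}\,{}^fA_{lj}^r\Big\}E_r+\Big\{\tfrac12 R_{ljr}{}^{s}t_s^v-\tfrac12R_{ljs}{}^{v}t_r^s\Big\}E_{\bar r},\\ ii)\ &\widetilde\nabla_{E_l}E_{\bar j}=\Big\{\tfrac1{2f}g_{ia}R^{s\,j}{}_{l}{}^{r}t_s^a-\tfrac1{2f}g^{jb}R_{isl}{}^{r}t_b^s\Big\}E_r+\Big\{\Gamma_{li}^v\delta_r^j-\Gamma_{lr}^j\delta_i^v\Big\}E_{\bar r},\\ iii)\ &\widetilde\nabla_{E_{\bar l}}E_j=\Big\{\tfrac1{2f}g_{ca}R^{s\,l}{}_{j}{}^{r}t_s^a-\tfrac1{2f}g^{lb}R_{csj}{}^{r}t_b^s\Big\}E_r,\\ iv)\ &\widetilde\nabla_{E_{\bar l}}E_{\bar j}=0 . \end{aligned}$$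
   Context: All objects are smooth; Einstein summation; Latin indices run over $1,\dots,n$, $n=\dim M$. $\nabla$ is the Levi-Civita connection of $g$ with Christoffel symbols $\Gamma_{ij}^h$; $R(X,Y)=[\nabla_X,\nabla_Y]-\nabla_{[X,Y]}$ and $R(\partial_k,\partial_l)\partial_j=R_{klj}{}^{s}\partial_s$; $R^{s\,j}{}_{l}{}^{r}:=g^{as}g^{bj}R_{abl}{}^{r}$. $f>0$ is a smooth function on $M$ (also regarded as a function on the bundle by pullback). $T^1_1(M)$ is the bundle of $(1,1)$-tensors, with induced local coordinates $(x^j,t_j^i)$, a point being $t=t_j^i\,\partial_i\otimes dx^j$ at $x$. The vertical lift of a $(1,1)$-tensor field $A$ is ${}^VA=A_j^i\,\partial/\partial t_j^i$; the horizontal lift of a vector field $X$ is ${}^HX=X^j\partial/\partial x^j+X^s(\Gamma_{sj}^mt_m^i-\Gamma_{sm}^it_j^m)\,\partial/\partial t_j^i$. The rescaled Sasaki type metric is defined by ${}^Sg_f({}^VA,{}^VB)=g_{ic}g^{jl}A_j^iB_l^c$, ${}^Sg_f({}^VA,{}^HY)=0$, ${}^Sg_f({}^HX,{}^HY)=f\,g(X,Y)$. Adapted frame: $E_j={}^H(\partial_j)$ and $E_{\bar j}={}^V(\partial_i\otimes dx^j)$, where $\bar j$ stands for the pair $(i,j)$; similarly $E_{\bar l}={}^V(\partial_c\otimes dx^l)$ and $E_{\bar r}={}^V(\partial_v\otimes dx^r)$, with summation over both $v$ and $r$ when $E_{\bar r}$ is summed. Finally ${}^fA_{ji}^h=f_j\delta_i^h+f_i\delta_j^h-f^hg_{ji}$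 with $f_i=\partial_if$, $f^h=g^{hm}f_m$. *)

(* Defs.v *)
From HB Require Import structures.
From mathcomp Require Import all_boot all_order all_algebra.
From mathcomp Require Import all_classical all_reals all_analysis.
Import Order.TTheory GRing.Theory Num.Theory.
Import numFieldNormedType.Exports.

Set Implicit Arguments.
Unset Strict Implicit.
Unset Printing Implicit Defensive.

Local Open Scope classical_set_scope.
Local Open Scope ring_scope.

Section Smooth.
Variables (R : realType) (E F : normedModType R).

Fixpoint iterD (s : seq E) (h : E -> F) : E -> F :=
  if s is v :: s' then fun y => 'D_v (iterD s' h) y else h.

(* Meant for U open and E finite dimensional: all iterated directional
   derivatives exist and are differentiable on U, i.e. h is C^oo on U. *)
Definition smooth_on (U : set E) (h : E -> F) : Prop :=
  forall (s : seq E) (y : E), U y -> differentiable (iterD s h) y.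

End Smooth.

Record atlas (T E : Type) := Atlas {
  chart : Type;
  chart_dom : chart -> set T;
  chart_map : chart -> T -> E }.

Arguments chart_dom {T E a} c _.
Arguments chart_map {T E a} c _.

Section Charts.
Variables (T E : Type) (A : atlas T E).

Definition chart_im (c : chart A) : set E := chart_map c @` chart_dom c.

Definition chart_overlap (c d : chart A) : set E := chart_map c @` (chart_dom c `&` chart_dom d).

(* The expression of h in the chart c, i.e. h o (chart_map c)^-1 on chart_im c
   (and 0 outside of chart_im c). *)
Definition chart_expr (F : zmodType) (c : chart A) (h : T -> F) (y : E) : F :=
  xget 0 (h @` [set p | chart_dom c p /\ chart_map c p = y]).

End Charts.

Definition chart_trans (T : Type) (E : zmodType) (A : atlas T E) (c d : chart A)
  : E -> E := chart_expr c (chart_map d).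

Record smooth_manifold (R : realType) (E : normedModType R)
    (M : topologicalType) (A : atlas M E) : Prop := {
  mfd_hausdorff : hausdorff_space M;
  mfd_second_countable : @second_countable M;
  mfd_cover : forall p : M, exists c : chart A, chart_dom c p;
  mfd_dom_open : forall c : chart A, open (chart_dom c);
  mfd_inj : forall c : chart A, set_inj (chart_dom c) (chart_map c);
  (* with the previous two fields: chart_map c is a homeomorphism of
     chart_dom c onto an open subset of E *)
  mfd_homeo : forall (c : chart A) (U : set M), U `<=` chart_dom c ->
    (open U <-> open (chart_map c @` U));
  mfd_smooth : forall c d : chart A,
    smooth_on (chart_overlap c d) (chart_trans c d) }.

Definition smooth_fun (R : realType) (E : normedModType R) (T : Type)
    (A : atlas T E) (h : T -> R) : Prop :=
  forall c : chart A, smooth_on (chart_im c) (chart_expr c h).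

(* A vector field on an open part of the domain of a chart c is given by its
   components in c, as a function of the coordinates: it is a function
   X : E -> E that is smooth on an open W included in chart_im c. A change of
   chart acts on components by the derivative of the transition map. *)

Section Riemannian.
Variables (R : realType) (E : normedModType R) (T : Type) (A : atlas T E).

(* G c y u v = value of the metric, at the point with coordinates y in the
   chart c, on the two tangent vectors with components u and v in c. *)
Record riemannian_metric (G : chart A -> E -> E -> E -> R) : Prop := {
  rm_linear : forall c y a u u' v, chart_im c y ->
    G c y (a *: u + u') v = a * G c y u v + G c y u' v;
  rm_sym : forall c y u v, chart_im c y -> G c y u v = G c y v u;
  rm_pos : forall c y u, chart_im c y -> u != 0 -> 0 < G c y u u;
  rm_smooth : forall c u v, smooth_on (chart_im c) (fun y => G c y u v);
  rm_trans : forall c d y u v, chart_overlap c d y ->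
    G c y u v = G d (chart_trans c d y) ('D_u (chart_trans c d) y) ('D_v (chart_trans c d) y) }.

Definition lie_bracket (X Y : E -> E) (y : E) : E :=
  'D_(X y) Y y - 'D_(Y y) X y.

(* D c X Y = components in c of the covariant derivative of Y along X; it is
   constrained only on the open sets on which X and Y are smooth. *)
Record is_connection (D : chart A -> (E -> E) -> (E -> E) -> E -> E) : Prop := {
  conn_smooth : forall c (W : set E) X Y, open W -> W `<=` chart_im c ->
    smooth_on W X -> smooth_on W Y -> smooth_on W (D c X Y);
  conn_local : forall c (W : set E) X X' Y Y', open W -> W `<=` chart_im c ->
    smooth_on W X -> smooth_on W X' -> smooth_on W Y -> smooth_on W Y' ->
    (forall y, W y -> X y = X' y) -> (forall y, W y -> Y y = Y' y) ->
    forall y, W y -> D c X Y y = D c X' Y' y;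
  conn_addl : forall c (W : set E) X X' Y, open W -> W `<=` chart_im c ->
    smooth_on W X -> smooth_on W X' -> smooth_on W Y ->
    forall y, W y ->
      D c (fun z => X z + X' z) Y y = D c X Y y + D c X' Y y;
  conn_scalel : forall c (W : set E) (h : E -> R) X Y, open W -> W `<=` chart_im c ->
    smooth_on W h -> smooth_on W X -> smooth_on W Y ->
    forall y, W y -> D c (fun z => h z *: X z) Y y = h y *: D c X Y y;
  conn_addr : forall c (W : set E) X Y Y', open W -> W `<=` chart_im c ->
    smooth_on W X -> smooth_on W Y -> smooth_on W Y' ->
    forall y, W y ->
      D c X (fun z => Y z + Y' z) y = D c X Y y + D c X Y' y;
  conn_leibniz : forall c (W : set E) (h : E -> R) X Y, open W -> W `<=` chart_im c ->
    smooth_on W h -> smooth_on W X -> smooth_on W Y ->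
    forall y, W y ->
      D c X (fun z => h z *: Y z) y = 'D_(X y) h y *: Y y + h y *: D c X Y y;
  (* D is the same operator in all charts *)
  conn_trans : forall c d (W : set E) X Y X' Y',
    open W -> W `<=` chart_overlap c d ->
    smooth_on W X -> smooth_on W Y ->
    smooth_on (chart_trans c d @` W) X' -> smooth_on (chart_trans c d @` W) Y' ->
    (forall y, W y -> X' (chart_trans c d y) = 'D_(X y) (chart_trans c d) y) ->
    (forall y, W y -> Y' (chart_trans c d y) = 'D_(Y y) (chart_trans c d) y) ->
    forall y, W y ->
      D d X' Y' (chart_trans c d y) = 'D_(D c X Y y) (chart_trans c d) y }.

Record levi_civita (G : chart A -> E -> E -> E -> R)
    (D : chart A -> (E -> E) -> (E -> E) -> E -> E) : Prop := {
  lc_connection : is_connection D;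
  lc_torsion_free : forall c (W : set E) X Y, open W -> W `<=` chart_im c ->
    smooth_on W X -> smooth_on W Y ->
    forall y, W y -> D c X Y y - D c Y X y = lie_bracket X Y y;
  lc_metric : forall c (W : set E) X Y Z, open W -> W `<=` chart_im c ->
    smooth_on W X -> smooth_on W Y -> smooth_on W Z ->
    forall y, W y ->
      'D_(X y) (fun z => G c z (Y z) (Z z)) y =
        G c y (D c X Y y) (Z y) + G c y (Y y) (D c X Z y) }.

Definition curvature (D : chart A -> (E -> E) -> (E -> E) -> E -> E)
    (c : chart A) (X Y Z : E -> E) (y : E) : E :=
  D c X (D c Y Z) y - D c Y (D c X Z) y - D c (lie_bracket X Y) Z y.

End Riemannian.

(* A point of R^n is a row vector; components are functions of the
   coordinates y in the chart c. *)

Definition basis_vec (R : realType) (n : nat) (i : 'I_n) : 'rV[R]_n :=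
  delta_mx 0 i.

Section Indices.
Variables (R : realType) (n : nat) (T : Type) (A : atlas T 'rV[R]_n).

Variable g : chart A -> 'rV[R]_n -> 'rV[R]_n -> 'rV[R]_n -> R.
Variable D : chart A -> ('rV[R]_n -> 'rV[R]_n) -> ('rV[R]_n -> 'rV[R]_n) ->
  'rV[R]_n -> 'rV[R]_n.

Definition coord_field (i : 'I_n) : 'rV[R]_n -> 'rV[R]_n :=
  fun=> basis_vec R i.

(* g_{ij} *)
Definition glow (c : chart A) (y : 'rV[R]_n) (i j : 'I_n) : R :=
  g c y (basis_vec R i) (basis_vec R j).

(* g^{ij} *)
Definition gup (c : chart A) (y : 'rV[R]_n) (i j : 'I_n) : R :=
  invmx (\matrix_(a < n, b < n) glow c y a b) i j.

(* Gamma_{ij}^h *)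
Definition christoffel (c : chart A) (y : 'rV[R]_n) (i j h : 'I_n) : R :=
  D c (coord_field i) (coord_field j) y 0 h.

(* R_{klj}^s *)
Definition riem (c : chart A) (y : 'rV[R]_n) (k l j s : 'I_n) : R :=
  curvature D c (coord_field k) (coord_field l) (coord_field j) y 0 s.

(* R^{s j}_l^r = g^{as} g^{bj} R_{abl}^r *)
Definition riem_up (c : chart A) (y : 'rV[R]_n) (s j l r : 'I_n) : R :=
  \sum_(a < n) \sum_(b < n) gup c y a s * gup c y b j * riem c y a b l r.

(* f_i *)
Definition grad_low (f : T -> R) (c : chart A) (y : 'rV[R]_n) (i : 'I_n) : R :=
  'D_(basis_vec R i) (chart_expr c f) y.

(* f^h *)
Definition grad_up (f : T -> R) (c : chart A) (y : 'rV[R]_n) (h : 'I_n) : R :=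
  \sum_(m < n) gup c y h m * grad_low f c y m.

(* ^fA_{ji}^h *)
Definition fA (f : T -> R) (c : chart A) (y : 'rV[R]_n) (j i h : 'I_n) : R :=
  grad_low f c y j * (i == h)%:R + grad_low f c y i * (j == h)%:R
  - grad_up f c y h * glow c y j i.

End Indices.

Section TensorBundle.
Variables (R : realType) (n : nat) (M : Type) (A : atlas M 'rV[R]_n).

(* d x_d^a / d x_c^i at the point with coordinates y in the chart c *)
Definition chart_jac (c d : chart A) (y : 'rV[R]_n) (a i : 'I_n) : R :=
  'D_(basis_vec R i) (chart_trans c d) y 0 a.

(* A (1,1)-tensor at the point tbase, as the family of its components: row i,
   column j of tcomp c is t_j^i in the chart c. The components in the charts
   not defined at tbase are set to 0, so that equality of tensors is
   equality in this type. *)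
Record T11 := MkT11 {
  tbase : M;
  tcomp : chart A -> 'M[R]_n;
  tlaw : forall (c d : chart A), chart_dom c tbase -> chart_dom d tbase -> forall a b,
    tcomp d a b = \sum_(i < n) \sum_(j < n)
      chart_jac c d (chart_map c tbase) a i * chart_jac d c (chart_map d tbase) j b * tcomp c i j;
  tnorm : forall c : chart A, ~ chart_dom c tbase -> tcomp c = 0 }.

(* The induced charts (x^j, t_j^i). *)
Definition T11_atlas : atlas T11 ('rV[R]_n * 'M[R]_n)%type :=
  @Atlas T11 ('rV[R]_n * 'M[R]_n)%type (chart A)
    (fun c t => chart_dom c (tbase t))
    (fun c t => (chart_map c (tbase t), tcomp t c)).

Variable g : chart A -> 'rV[R]_n -> 'rV[R]_n -> 'rV[R]_n -> R.
Variable D : chart A -> ('rV[R]_n -> 'rV[R]_n) -> ('rV[R]_n -> 'rV[R]_n) ->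
  'rV[R]_n -> 'rV[R]_n.

(* Lifts of a (1,1)-tensor field B and of a vector field X, given by their
   components in the chart c, in the induced chart: z = (x, t). *)
Definition vlift (B : 'rV[R]_n -> 'M[R]_n) (z : 'rV[R]_n * 'M[R]_n)
  : 'rV[R]_n * 'M[R]_n := (0, B z.1).

Definition hlift (c : chart A) (X : 'rV[R]_n -> 'rV[R]_n)
    (z : 'rV[R]_n * 'M[R]_n) : 'rV[R]_n * 'M[R]_n :=
  (X z.1,
   \matrix_(i < n, j < n) \sum_(s < n) X z.1 0 s *
     (\sum_(m < n) christoffel D c z.1 s j m * z.2 i m
      - \sum_(m < n) christoffel D c z.1 s m i * z.2 m j)).

Record rescaled_sasaki (f : M -> R)
    (G : chart T11_atlas -> 'rV[R]_n * 'M[R]_n -> 'rV[R]_n * 'M[R]_n ->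
         'rV[R]_n * 'M[R]_n -> R) : Prop := {
  rs_metric : riemannian_metric G;
  rs_vv : forall (c : chart A) (W : set 'rV[R]_n) (B C : 'rV[R]_n -> 'M[R]_n),
    open W -> W `<=` chart_im c -> smooth_on W B -> smooth_on W C ->
    forall t : T11, chart_dom c (tbase t) -> W (chart_map c (tbase t)) ->
    let z := (chart_map c (tbase t), tcomp t c) in
    G c z (vlift B z) (vlift C z) =
      \sum_(i < n) \sum_(k < n) \sum_(j < n) \sum_(l < n)
        glow g c z.1 i k * gup g c z.1 j l * B z.1 i j * C z.1 k l;
  rs_vh : forall (c : chart A) (W : set 'rV[R]_n) (B : 'rV[R]_n -> 'M[R]_n)
    (Y : 'rV[R]_n -> 'rV[R]_n),
    open W -> W `<=` chart_im c -> smooth_on W B -> smooth_on W Y ->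
    forall t : T11, chart_dom c (tbase t) -> W (chart_map c (tbase t)) ->
    let z := (chart_map c (tbase t), tcomp t c) in
    G c z (vlift B z) (hlift c Y z) = 0;
  rs_hh : forall (c : chart A) (W : set 'rV[R]_n)
    (X Y : 'rV[R]_n -> 'rV[R]_n),
    open W -> W `<=` chart_im c -> smooth_on W X -> smooth_on W Y ->
    forall t : T11, chart_dom c (tbase t) -> W (chart_map c (tbase t)) ->
    let z := (chart_map c (tbase t), tcomp t c) in
    G c z (hlift c X z) (hlift c Y z) =
      f (tbase t) * g c z.1 (X z.1) (Y z.1) }.

(* Adapted frame: E_j and, for the pair (i, j), E_{\bar j}. *)
Definition Ehor (c : chart A) (j : 'I_n) :
  'rV[R]_n * 'M[R]_n -> 'rV[R]_n * 'M[R]_n := hlift c (@coord_field R n j).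

Definition Ever (i j : 'I_n) :
  'rV[R]_n * 'M[R]_n -> 'rV[R]_n * 'M[R]_n := vlift (fun=> delta_mx i j).

End TensorBundle.

(* Main.v *)
Require Import Defs.
From HB Require Import structures.
From mathcomp Require Import all_boot all_order all_algebra.
From mathcomp Require Import all_classical all_reals all_analysis.
From mathcomp Require Import ring lra.
Import Order.TTheory GRing.Theory Num.Theory.
Import numFieldNormedType.Exports.
(** The formulas are the Koszul formula evaluated on the adapted frame.

    In a chart of the base let Gam_k be the matrix with entry Gam_{kj}^s in row
    s and column j, let R_kl be the matrix with entry R_{klj}^s in row s and
    column j, let t be the matrix of fibre coordinates, and write [a, b] for
    the commutator of matrices.  The horizontal lift of the k-th coordinate
    field is E_k = (e_k, [t, Gam_k]), and a constant vertical field is (0, B).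
    Their brackets are (bracket_hor_hor, bracket_hor_vert)
      [E_k, E_l] = (0, [t, R_kl])   and   [E_k, (0, B)] = (0, [Gam_k, B]),
    and vertical fields commute.  The metric takes on the frame the values f g,
    0 and H(B, C) = tr (B^T g C g^-1).  All of them depend on the base point
    only, and H is parallel (derive_fibre_metric):
      d_k H(B, C) = H([Gam_k, B], C) + H(B, [Gam_k, C]).
    The Koszul formula (koszul) now gives the product of every covariant
    derivative with every frame field, and these products determine the
    derivative because the metric is positive definite and the frame spans
    (frame_decomposition).

    For two horizontal fields, the horizontal part is the Christoffel symbol of
    the conformal metric f g (scaled_koszul), and the vertical part is half of
    their bracket.  For a horizontal and a vertical field, the vertical part is
    the bracket, by parallelism of H, and the horizontal part X is given by
      2 f g(X, e_k) = - H([t, R_lk], B).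
    To recognise in it the stated coefficients one must move the free index k
    from the first pair of indices of the curvature to the second one
    (lower_mixed).  This rests on the symmetry R_klij = R_ijkl, hence on the
    first Bianchi identity and on the skewness of g R_kl; the latter expresses
    that second derivatives of g commute (schwarz).  The third formula follows
    from the second by vanishing of the torsion, and for two vertical fields
    all products vanish, again by parallelism of H.

    Two facts allow these computations.  The image of an induced chart of the
    bundle is the product of the image of the chart of the base with all
    matrices, thus open (T11_chart_im): every matrix is the component of a
    tensor, by the chain rule for the transition maps.  And the frame is
    smooth, which comes from a coinduction principle for smooth functions
    (smooth_on_coind). *)

Set Implicit Arguments.
Unset Strict Implicit.
Unset Printing Implicit Defensive.
Local Open Scope classical_set_scope.
Local Open Scope ring_scope.

(** * Calculus of smooth functions on an open set *)
Section Calculus.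
Variables (R : realType).

(** The difference of the two functions vanishes near the point, so it is a
    little-o of the increment and its differential is zero. *)
Lemma near_eq_differentiable (E F : normedModType R) (f h : E -> F) x :
  (\forall y \near x, f y = h y) -> differentiable f x -> differentiable h x.
Proof.
move=> fh df.
have -> : h = f + (h - f) by rewrite addrC subrK.
apply: differentiableD => //.
set k := h - f.
have k0 : \forall y \near x, k y = 0.
  by near=> y; rewrite /k /GRing.add /GRing.opp /= (near fh y) ?subrr //.
have o0 : k \o shift x = cst (k x) + (0 : E -> F) +o_ 0 id.
  rewrite (nbhs_singleton k0) addr0; apply/eqaddoP => e e0 /=.
  have : \forall y \near 0, k (y + x) = 0.
    move: k0; rewrite (near_shift 0 x) /=.
    by apply: filterS => y /=; rewrite subr0.
  apply: filterS => y /= ky0.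
  by rewrite /GRing.add /GRing.opp /= ky0 subrr normr0 mulr_ge0 // ltW.
have c0 : continuous (0 : E -> F) by move=> y; exact: cvg_cst.
apply/diff_locallyP.
have -> : 'd k x = \0 :> (E -> F).
  by apply: (@diff_unique _ _ _ k (\0 : {linear E -> F})%R x).
by split.
Unshelve. all: by end_near. Qed.

Section LinearMaps.
Variables (E F F' : normedModType R).

Lemma derive_comp_linear (L : {linear F -> F'}) (X : E -> F) v y :
  continuous L -> differentiable X y ->
  'D_v (L \o X) y = L ('D_v X y).
Proof.
move=> cL dX; have dL : differentiable L (X y) by exact: linear_differentiable.
rewrite !deriveE //; last exact: differentiable_comp.
by rewrite diff_comp //= diff_lin.
Qed.

Lemma derive_precomp_linear (L : {linear E -> F}) (h : F -> F') v y :
  continuous L -> differentiable h (L y) ->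
  'D_v (h \o L) y = 'D_(L v) h (L y).
Proof.
move=> cL dh; have dL : differentiable L y by exact: linear_differentiable.
rewrite !deriveE //; last exact: differentiable_comp.
by rewrite diff_comp //= diff_lin.
Qed.

End LinearMaps.

Section SmoothOn.
Variables (E F : normedModType R) (U : set E).
Implicit Types h f : E -> F.

Lemma iterD_rcons (s : seq E) v h :
  Defs.iterD (rcons s v) h = Defs.iterD s ('D_v h).
Proof. by elim: s => //= w s ->. Qed.

Lemma smooth_on_differentiable h : smooth_on U h ->
  forall y, U y -> differentiable h y.
Proof. by move=> sh y Uy; exact: (sh [::]). Qed.

Lemma smooth_on_derive h v : smooth_on U h -> smooth_on U ('D_v h).
Proof. by move=> sh s y Uy; rewrite -iterD_rcons; exact: sh. Qed.

Lemma smooth_onS h : (forall y, U y -> differentiable h y) ->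
  (forall v, smooth_on U ('D_v h)) -> smooth_on U h.
Proof.
move=> dh sh s; case/lastP: s => [|s v] y Uy; first exact: dh.
by rewrite iterD_rcons; exact: sh.
Qed.

Hypothesis openU : open U.

Lemma derive_eq_on (f h : E -> F) v : (forall y, U y -> f y = h y) ->
  forall y, U y -> 'D_v f y = 'D_v h y.
Proof.
move=> fh y Uy; apply: near_eq_derive.
by apply: filterS (open_nbhs_nbhs (conj openU Uy)) => z /fh.
Qed.

Lemma differentiable_eq_on (f h : E -> F) : (forall y, U y -> f y = h y) ->
  forall y, U y -> differentiable f y -> differentiable h y.
Proof.
move=> fh y Uy; apply: near_eq_differentiable.
by apply: filterS (open_nbhs_nbhs (conj openU Uy)) => z /fh.
Qed.

Lemma smooth_on_eq (f h : E -> F) : (forall y, U y -> f y = h y) ->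
  smooth_on U f -> smooth_on U h.
Proof.
move=> fh sf s y Uy; apply: (differentiable_eq_on _ Uy (sf s y Uy)).
by elim: s {sf} => //= v s IH z Uz; exact: derive_eq_on.
Qed.

(** The derivatives of a sum, of a product or of a composite are expressions of
    the same kind.  A family that is stable under differentiation therefore
    consists of smooth functions; stability is asked up to equality on U since
    the rules of differentiation hold only there. *)
Lemma smooth_on_coind (P : (E -> F) -> Prop) :
  (forall h, P h -> (forall y, U y -> differentiable h y) /\
     (forall v, exists2 k, P k & forall y, U y -> 'D_v h y = k y)) ->
  forall h, P h -> smooth_on U h.
Proof.
move=> HP h Ph s; elim/last_ind: s h Ph => [|s v IH] h Ph y Uy.
  by have [dh _] := HP h Ph; exact: dh.
rewrite iterD_rcons; have [_ /(_ v)[k Pk kE]] := HP h Ph.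
have iE z : U z -> Defs.iterD s k z = Defs.iterD s ('D_v h) z.
  elim: s {IH} z => [|w s IH] z Uz /=; first by rewrite kE.
  exact: derive_eq_on.
exact: differentiable_eq_on iE y Uy (IH k Pk y Uy).
Qed.

Lemma smooth_on_cst (w : F) : smooth_on U (cst w : E -> F).
Proof.
apply: (@smooth_on_coind (fun h => exists w : F, h = cst w)); last by exists w.
move=> _ [{}w ->]; split => [y _|v]; first exact: differentiable_cst.
by exists (cst 0) => [|y _]; [exists 0|rewrite derive_cst].
Qed.

Lemma smooth_on_add (f h : E -> F) : smooth_on U f -> smooth_on U h ->
  smooth_on U (fun y => f y + h y).
Proof.
move=> sf sh.
apply: (@smooth_on_coind (fun k => exists f h,
  [/\ smooth_on U f, smooth_on U h & k = f + h])); last by exists f, h.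
move=> _ [{sf}f [{sh}h [sf sh ->]]]; split=> [y Uy|v].
  by apply: differentiableD; exact: smooth_on_differentiable Uy.
exists ('D_v f + 'D_v h).
  by exists ('D_v f), ('D_v h); split=> //; exact: smooth_on_derive.
by move=> y Uy; rewrite deriveD //; apply: diff_derivable;
  exact: smooth_on_differentiable Uy.
Qed.

Lemma smooth_on_sum (I : finType) (P : pred I) (f : I -> E -> F) :
  (forall i, smooth_on U (f i)) ->
  smooth_on U (fun y => \sum_(i | P i) f i y).
Proof.
move=> sf.
have -> : (fun y => \sum_(i | P i) f i y) = \sum_(i | P i) f i.
  by apply/funext => y; rewrite fct_sumE.
elim/big_ind: _ => //; first exact: smooth_on_cst.
by move=> ? ?; exact: smooth_on_add.
Qed.

End SmoothOn.

Lemma smooth_on_subset (E F : normedModType R) (U V : set E) (h : E -> F) :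
  V `<=` U -> smooth_on U h -> smooth_on V h.
Proof. by move=> VU sh s y /VU; exact: sh. Qed.

Section SmoothLinear.
Variables (E F F' : normedModType R).

Lemma smooth_on_comp_linear (U : set E) (L : {linear F -> F'}) (X : E -> F) :
  open U -> continuous L -> smooth_on U X -> smooth_on U (L \o X).
Proof.
move=> oU cL sX.
apply: (@smooth_on_coind _ _ _ oU (fun k => exists2 X, smooth_on U X & k = L \o X));
  last by exists X.
move=> _ [{sX}X sX ->]; split=> [y Uy|v].
  apply: differentiable_comp; first exact: smooth_on_differentiable Uy.
  exact: linear_differentiable.
exists (L \o 'D_v X); first by exists ('D_v X) => //; exact: smooth_on_derive.
by move=> y Uy; rewrite derive_comp_linear //; exact: smooth_on_differentiable Uy.
Qed.

Lemma smooth_on_precomp_linear (U : set F) (L : {linear E -> F}) (h : F -> F') :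
  open U -> continuous L -> smooth_on U h -> smooth_on (L @^-1` U) (h \o L).
Proof.
move=> oU cL sh.
have oU' : open (L @^-1` U) by apply: open_comp => // y _; exact: cL.
apply: (@smooth_on_coind _ _ _ oU' (fun k => exists2 h, smooth_on U h & k = h \o L));
  last by exists h.
move=> _ [{sh}h sh ->]; split=> [y Uy|v].
  apply: differentiable_comp; first exact: linear_differentiable.
  exact: smooth_on_differentiable sh _ Uy.
exists ('D_(L v) h \o L); first by exists ('D_(L v) h) => //; exact: smooth_on_derive.
move=> y Uy; rewrite derive_precomp_linear //.
exact: smooth_on_differentiable sh _ Uy.
Qed.

Lemma smooth_on_linear (U : set E) (L : {linear E -> F}) :
  continuous L -> smooth_on U L.
Proof.
move=> cL; apply: smooth_on_subset (@subsetT _ U) _.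
apply: smooth_onS => [y _|v]; first exact: linear_differentiable.
apply: (@smooth_on_eq _ _ _ openT (cst (L v))); last first.
  by apply: smooth_on_cst; exact: openT.
by move=> y _; rewrite deriveE ?diff_lin //; exact: linear_differentiable.
Qed.

End SmoothLinear.

Section SmoothReal.
Variables (E : normedModType R) (U : set E).
Hypothesis openU : open U.
Implicit Types f h : E -> R.

(** This family is stable under differentiation, up to equality on U, by the
    rules for f + h, f h and 1 / f; one coinduction then gives the smoothness
    of products and of inverses, whose derivatives involve sums and products. *)
Inductive smooth_generated : (E -> R) -> Prop :=
| sgen_base h : smooth_on U h -> smooth_generated h
| sgen_add f h : smooth_generated f -> smooth_generated h ->
    smooth_generated (f + h)
| sgen_mul f h : smooth_generated f -> smooth_generated h ->
    smooth_generated (f * h)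
| sgen_inv f : smooth_generated f -> (forall y, U y -> f y != 0) ->
    smooth_generated (fun y => (f y)^-1).

Lemma smooth_generated_smooth_on h : smooth_generated h -> smooth_on U h.
Proof.
move: h; apply: smooth_on_coind => // h; elim=> {h}.
- move=> h sh; split=> [y Uy|v]; first exact: smooth_on_differentiable Uy.
  by exists ('D_v h) => //; apply: sgen_base; exact: smooth_on_derive.
- move=> f h sf [df Df] sh [dh Dh]; split=> [y Uy|v].
    by apply: differentiableD; [exact: df|exact: dh].
  have [f' sf' f'E] := Df v; have [h' sh' h'E] := Dh v.
  exists (f' + h'); first exact: sgen_add.
  by move=> y Uy; rewrite deriveD ?f'E ?h'E //; apply: diff_derivable;
    [exact: df|exact: dh].
- move=> f h sf [df Df] sh [dh Dh]; split=> [y Uy|v].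
    by apply: differentiableM; [exact: df|exact: dh].
  have [f' sf' f'E] := Df v; have [h' sh' h'E] := Dh v.
  exists (f * h' + h * f'); first by apply: sgen_add; exact: sgen_mul.
  by move=> y Uy; rewrite deriveM ?f'E ?h'E //; apply: diff_derivable;
    [exact: df|exact: dh].
- move=> f sf [df Df] f0; split=> [y Uy|v].
    by apply: differentiableV; [exact: df|exact: f0].
  have [f' sf' f'E] := Df v.
  exists (cst (-1) * ((fun y => (f y)^-1) * (fun y => (f y)^-1)) * f').
    apply: sgen_mul => //; apply: sgen_mul; last by apply: sgen_mul; exact: sgen_inv.
    by apply: sgen_base; exact: smooth_on_cst.
  move=> y Uy; rewrite deriveV; [|exact: f0|by apply: diff_derivable; exact: df].
  rewrite f'E // -[RHS]/(-1 * ((f y)^-1 * (f y)^-1) * f' y).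
  by rewrite expr2 invfM mulN1r.
Qed.

Lemma smooth_on_mul f h : smooth_on U f -> smooth_on U h ->
  smooth_on U (fun y => f y * h y).
Proof.
move=> sf sh; apply: smooth_generated_smooth_on.
by apply: (@sgen_mul f h); exact: sgen_base.
Qed.

Lemma smooth_on_inv f : smooth_on U f -> (forall y, U y -> f y != 0) ->
  smooth_on U (fun y => (f y)^-1).
Proof.
move=> sf f0; apply: smooth_generated_smooth_on.
by apply: sgen_inv => //; exact: sgen_base.
Qed.

Lemma smooth_on_opp f : smooth_on U f -> smooth_on U (fun y => - f y).
Proof.
move=> sf; apply: (@smooth_on_eq _ _ _ openU (fun y => cst (-1) y * f y)).
  by move=> y _; rewrite /= mulN1r.
by apply: smooth_on_mul => //; exact: smooth_on_cst.
Qed.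

Lemma smooth_on_prod (I : finType) (P : pred I) (f : I -> E -> R) :
  (forall i, smooth_on U (f i)) ->
  smooth_on U (fun y => \prod_(i | P i) f i y).
Proof.
move=> sf.
have -> : (fun y => \prod_(i | P i) f i y) = \prod_(i | P i) f i.
  by apply/funext => y; rewrite fct_prodE.
elim/big_ind: _ => //; first exact: (@smooth_on_cst E R U openU (1 : R)).
by move=> ? ?; exact: smooth_on_mul.
Qed.

Lemma smooth_on_scale (F : normedModType R) f (w : F) :
  smooth_on U f -> smooth_on U (fun y => f y *: w).
Proof.
move=> sf.
have lin : linear (fun a : R => a *: w).
  by move=> a x y; rewrite scalerDl scalerA.
pose LM := GRing.isLinear.Build _ _ _ _ _ lin.
pose L : {linear _ -> _} := HB.pack (fun a : R => a *: w) LM.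
apply: (@smooth_on_comp_linear _ _ _ U L) => //.
exact: scalel_continuous.
Qed.

End SmoothReal.
End Calculus.

(** * Symmetry of second derivatives *)
Section Schwarz.
Variables (R : realType) (E : normedModType R).

Lemma is_derive_line (h : E -> R) (u w : E) (a : R) :
  differentiable h (a *: u + w) ->
  is_derive a 1 (fun b => h (b *: u + w)) ('D_u h (a *: u + w)).
Proof.
move=> /(diff_derivable (v := u)) dh.
have lineE : (fun e : R => e^-1 *: (((fun b => h (b *: u + w)) \o shift a) (e *: 1)
                             - h (a *: u + w)))
   = (fun e => e^-1 *: ((h \o shift (a *: u + w)) (e *: u) - h (a *: u + w))).
  by apply/funext => e /=; rewrite scalerDl addrA [e *: 1]mulr1.
by apply: DeriveDef; [rewrite /derivable lineE|rewrite /derive lineE].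
Qed.

Lemma mean_value_line (h : E -> R) (u w : E) (s : R) : 0 < s ->
  (forall a : R, a \in `[0, s] -> differentiable h (a *: u + w)) ->
  exists2 a, a \in `[0, s] & h (s *: u + w) - h w = s * 'D_u h (a *: u + w).
Proof.
move=> s0 dh.
have [||a as_ aE] := @MVT R (fun b => h (b *: u + w))
    (fun a => 'D_u h (a *: u + w)) 0 s s0.
- by move=> a as_; apply/is_derive_line/dh; exact: subset_itv_oo_cc.
- by apply: derivable_within_continuous => a /dh /is_derive_line [].
exists a; first exact: subset_itv_oo_cc.
by move: aE; rewrite scale0r add0r subr0 mulrC.
Qed.

Lemma derive_translate (h : E -> R) (v w x : E) :
  'D_v (fun z => h (z + w)) x = 'D_v h (x + w).
Proof.
rewrite /derive; set f := (fun e : R => _); set k := (fun e : R => _).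
by have -> : f = k by apply/funext => e; rewrite /f /k /= addrA.
Qed.

(** The mean value theorem is applied along u to the increment of h in the
    direction v, then along v to the derivative of h in the direction u. *)
Lemma second_difference (U : set E) (h : E -> R) (u v x : E) (s : R) : 0 < s ->
  smooth_on U h ->
  (forall a b : R, a \in `[0, s] -> b \in `[0, s] -> U (a *: u + (b *: v + x))) ->
  exists a b : R, [/\ a \in `[0, s], b \in `[0, s] &
    h (s *: u + (s *: v + x)) - h (s *: v + x) - (h (s *: u + x) - h x)
      = s * (s * 'D_v ('D_u h) (a *: u + (b *: v + x)))].
Proof.
move=> s0 sh abU.
have s1 : s \in `[0, s] by rewrite in_itv /= lexx ltW.
have z1 : 0 \in `[0, s] by rewrite in_itv /= lexx ltW.
pose k y := h (y + s *: v) - h y.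
have shift_diff y : U (y + s *: v) -> differentiable (fun z => h (z + s *: v)) y.
  move=> Uy; apply: (@differentiable_comp _ _ _ _ (fun z => z + s *: v) h) => //.
  exact: smooth_on_differentiable sh _ Uy.
have dk (a : R) : a \in `[0, s] -> differentiable k (a *: u + x).
  move=> ai; apply: differentiableB.
    by apply: shift_diff; rewrite -addrA [x + _]addrC; exact: abU.
  apply: (smooth_on_differentiable sh).
  by have := abU a 0 ai z1; rewrite scale0r add0r.
have [a ai aE] := mean_value_line s0 dk.
have [|b bi bE] := @mean_value_line ('D_u h) v (a *: u + x) s s0.
  move=> b bi; apply: (smooth_on_differentiable (smooth_on_derive _ sh)).
  by rewrite addrCA; exact: abU.
exists a, b; split=> //; rewrite [a *: u + _]addrCA -bE.
have -> : h (s *: u + (s *: v + x)) - h (s *: v + x) - (h (s *: u + x) - h x)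
    = k (s *: u + x) - k x.
  rewrite /k -[s *: u + x + s *: v]addrA [x + s *: v]addrC; ring.
rewrite aE; congr (_ * _).
rewrite deriveB; first last.
- apply: diff_derivable; apply: (smooth_on_differentiable sh).
  by have := abU a 0 ai z1; rewrite scale0r add0r.
- apply/diff_derivable/(shift_diff (a *: u + x)).
  by rewrite -addrA [x + _]addrC; exact: abU.
congr (_ - _).
by rewrite derive_translate addrC.
Qed.

Lemma dist_lt_double (p q r e : R) :
  `|p - r| < e -> `|q - r| < e -> `|p - q| < e + e.
Proof.
move=> pr qr; apply: le_lt_trans (ler_distD r p q) _.
by apply: ltrD => //; rewrite distrC.
Qed.

(** The second difference of h over a small parallelogram does not change when u
    and v are exchanged, and it is s^2 times either mixed derivative at some
    point of the parallelogram; continuity of both derivatives concludes. *)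
Lemma schwarz (U : set E) (h : E -> R) (u v x : E) : open U -> smooth_on U h ->
  U x -> 'D_u ('D_v h) x = 'D_v ('D_u h) x.
Proof.
move=> oU sh Ux; apply/eqP; rewrite -subr_eq0 -normr_eq0; apply/negPn/negP => d0.
set A := 'D_u ('D_v h); set B := 'D_v ('D_u h).
have [e e0 eE] : exists2 e : R, 0 < e & `|A x - B x| = e + e.
  exists (`|A x - B x| / 2); last exact: splitr.
  by rewrite divr_gt0 // lt_neqAle eq_sym d0 normr_ge0.
have near_x (k : E -> R) : smooth_on U k -> \forall y \near x, `|k x - k y| < e.
  move=> /smooth_on_differentiable /(_ x Ux) /differentiable_continuous.
  by move=> /cvgrPdist_lt /(_ e e0).
have nA := near_x A (smooth_on_derive _ (smooth_on_derive _ sh)).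
have nB := near_x B (smooth_on_derive _ (smooth_on_derive _ sh)).
have nU := open_nbhs_nbhs (conj oU Ux).
have : nbhs x (U `&` ([set y | `|A x - A y| < e] `&` [set y | `|B x - B y| < e])).
  exact: (filterI nU (filterI nA nB)).
move=> /nbhs_ballP [r /= r0 rP].
(* With s m = r / 2 the parallelogram of sides s u and s v lies in the ball. *)
pose m := `|u| + `|v| + 1.
have m0 : 0 < m by rewrite ltr_wpDl ?addr_ge0.
pose s := r / m / 2.
have s0 : 0 < s by rewrite !divr_gt0.
have inball (a b : R) (w w' : E) : a \in `[0, s] -> b \in `[0, s] ->
    `|w| + `|w'| = `|u| + `|v| ->
    ball x r (a *: w + (b *: w' + x)).
  move=> /itvP ai /itvP bi ww'.
  rewrite -ball_normE /ball_ /= addrA [_ + x]addrC opprD addrA subrr add0r normrN.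
  apply: le_lt_trans (ler_normD _ _) _; rewrite !normrZ !ger0_norm ?ai ?bi //.
  have -> : r = s * m + s * m by rewrite /s; field; rewrite gt_eqF.
  have sm : 0 < s * m by rewrite mulr_gt0.
  apply: (@le_lt_trans _ _ (s * `|w| + s * `|w'|)).
    by apply: lerD; apply: ler_wpM2r; rewrite ?ai ?bi.
  rewrite -mulrDr ww' (le_lt_trans _ (_ : s * m < _)) ?ltrDl //.
  by rewrite ler_wpM2l ?(ltW s0) // lerDl.
have [a [b [ai bi]]] := @second_difference U h v u x s s0 sh
  (fun a b ai bi => (rP _ (inball _ _ _ _ ai bi (addrC _ _))).1).
have [a' [b' [ai' bi']]] := @second_difference U h u v x s s0 sh
  (fun a b ai bi => (rP _ (inball _ _ _ _ ai bi erefl)).1).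
have -> : h (s *: u + (s *: v + x)) - h (s *: v + x) - (h (s *: u + x) - h x) =
  h (s *: v + (s *: u + x)) - h (s *: u + x) - (h (s *: v + x) - h x).
  by rewrite addrCA; ring.
move=> -> /(mulfI (lt0r_neq0 s0)) /(mulfI (lt0r_neq0 s0)).
move=> BA; have {}BA : B (a' *: u + (b' *: v + x)) = A (a *: v + (b *: u + x)) := BA.
have [_ [+ _]] := rP _ (inball _ _ _ _ ai bi (addrC _ _)).
have [_ [_]] := rP _ (inball _ _ _ _ ai' bi' erefl).
rewrite /= BA => lB lA.
by have := dist_lt_double lA lB; rewrite eE ltxx.
Qed.

End Schwarz.

(** * Matrix-valued functions *)
Section MatrixCalculus.
Variables (R : realType) (E : normedModType R).

Lemma derivable_mulmx m n p (M : E -> 'M[R]_(m, n)) (N : E -> 'M[R]_(n, p)) x v :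
  derivable M x v -> derivable N x v -> derivable (fun y => M y *m N y) x v.
Proof.
move=> /derivable_mxP dM /derivable_mxP dN; apply/derivable_mxP => i j.
have -> : (fun y => (M y *m N y) i j) =
    \sum_(k < n) ((fun y => M y i k) * (fun y => N y k j)).
  by apply/funext => y; rewrite mxE fct_sumE.
by apply: derivable_sum => k; exact: derivableM.
Qed.

Lemma derive_mulmx m n p (M : E -> 'M[R]_(m, n)) (N : E -> 'M[R]_(n, p)) x v :
  derivable M x v -> derivable N x v ->
  'D_v (fun y => M y *m N y) x = 'D_v M x *m N x + M x *m 'D_v N x.
Proof.
move=> dM dN; rewrite derive_mx; last exact: derivable_mulmx.
rewrite (derive_mx dM) (derive_mx dN).
move/derivable_mxP: dM => dM; move/derivable_mxP: dN => dN.
apply/matrixP => i j; rewrite !mxE -big_split /=.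
have -> : (fun y => (M y *m N y) i j) =
    \sum_(k < n) ((fun y => M y i k) * (fun y => N y k j)).
  by apply/funext => y; rewrite mxE fct_sumE.
rewrite derive_sum; last by move=> k; exact: derivableM.
apply: eq_bigr => k _; rewrite deriveM // !mxE addrC; congr (_ + _).
by rewrite mulrC.
Qed.

Lemma derivable_mulmxl m n p (B : 'M[R]_(m, n)) (N : E -> 'M[R]_(n, p)) x v :
  derivable N x v -> derivable (fun y => B *m N y) x v.
Proof. exact: (derivable_mulmx (M := cst B) (derivable_cst B x v)). Qed.

Lemma derive_mulmxl m n p (B : 'M[R]_(m, n)) (N : E -> 'M[R]_(n, p)) x v :
  derivable N x v -> 'D_v (fun y => B *m N y) x = B *m 'D_v N x.
Proof.
move=> dN; have := derive_mulmx (M := cst B) (derivable_cst B x v) dN.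
by rewrite derive_cst mul0mx add0r.
Qed.

Lemma derivable_mulmxr m n p (M : E -> 'M[R]_(m, n)) (C : 'M[R]_(n, p)) x v :
  derivable M x v -> derivable (fun y => M y *m C) x v.
Proof. by move=> dM; exact: (derivable_mulmx dM (derivable_cst C x v)). Qed.

Lemma derive_mulmxr m n p (M : E -> 'M[R]_(m, n)) (C : 'M[R]_(n, p)) x v :
  derivable M x v -> 'D_v (fun y => M y *m C) x = 'D_v M x *m C.
Proof.
move=> dM; have := derive_mulmx dM (derivable_cst C x v).
by rewrite derive_cst mulmx0 addr0.
Qed.

Lemma derive_mxtrace n (M : E -> 'M[R]_n) x v :
  derivable M x v -> 'D_v (fun y => \tr (M y)) x = \tr ('D_v M x).
Proof.
move=> dM; have -> : (fun y => \tr (M y)) = \sum_(i < n) (fun y => M y i i).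
  by apply/funext => z; rewrite fct_sumE.
rewrite derive_sum => [|k]; last by move/derivable_mxP: dM; apply.
by rewrite (derive_mx dM) /mxtrace; apply: eq_bigr => i _; rewrite mxE.
Qed.

Lemma derivable_trmx m n (M : E -> 'M[R]_(m, n)) x v :
  derivable M x v -> derivable (fun y => (M y)^T) x v.
Proof.
move=> /derivable_mxP dM; apply/derivable_mxP => i j.
have -> : (fun y => (M y)^T i j) = (fun y => M y j i).
  by apply/funext => y; rewrite mxE.
exact: dM.
Qed.

Lemma derive_trmx m n (M : E -> 'M[R]_(m, n)) x v :
  derivable M x v -> 'D_v (fun y => (M y)^T) x = ('D_v M x)^T.
Proof.
move=> dM; rewrite (derive_mx (derivable_trmx dM)) (derive_mx dM).
apply/matrixP => i j; rewrite [LHS]mxE [RHS]mxE [RHS]mxE.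
have -> : (fun y => (M y)^T i j) = (fun y => M y j i).
  by apply/funext => y; rewrite mxE.
by [].
Qed.

Lemma smooth_on_entry m n (U : set E) (M : E -> 'M[R]_(m, n)) i j :
  open U -> smooth_on U M -> smooth_on U (fun y => M y i j).
Proof.
move=> oU sM.
have lin : linear (fun N : 'M[R]_(m, n) => N i j) by move=> a x y; rewrite !mxE.
pose LM := GRing.isLinear.Build _ _ _ _ _ lin.
pose L : {linear _ -> _} := HB.pack (fun N : 'M[R]_(m, n) => N i j) LM.
apply: (@smooth_on_comp_linear _ _ _ _ U L) => //.
exact: coord_continuous.
Qed.

Lemma smooth_on_matrix m n (U : set E) (M : E -> 'M[R]_(m, n)) :
  open U -> (forall i j, smooth_on U (fun y => M y i j)) -> smooth_on U M.
Proof.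
move=> oU sM.
apply: (@smooth_on_eq _ _ _ _ oU (fun y => \sum_i \sum_j M y i j *: delta_mx i j)).
  by move=> y _; rewrite [RHS]matrix_sum_delta.
apply: smooth_on_sum => // i; apply: smooth_on_sum => // j.
exact: smooth_on_scale.
Qed.

Lemma smooth_on_mulmx m n p (U : set E) (M : E -> 'M[R]_(m, n))
    (N : E -> 'M[R]_(n, p)) :
  open U -> smooth_on U M -> smooth_on U N -> smooth_on U (fun y => M y *m N y).
Proof.
move=> oU sM sN; apply: smooth_on_matrix => // i j.
apply: (@smooth_on_eq _ _ _ _ oU (fun y => \sum_k M y i k * N y k j)).
  by move=> y _; rewrite mxE.
apply: smooth_on_sum => // k.
by apply: smooth_on_mul => //; exact: smooth_on_entry.
Qed.

Lemma smooth_on_det n (U : set E) (M : E -> 'M[R]_n) :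
  open U -> smooth_on U M -> smooth_on U (fun y => \det (M y)).
Proof.
move=> oU sM; rewrite /determinant.
apply: smooth_on_sum => // s; apply: smooth_on_mul => //.
  exact: smooth_on_cst.
by apply: smooth_on_prod => // i; exact: smooth_on_entry.
Qed.

(** Cramer's rule expresses the inverse by the cofactors and the inverse of the
    determinant. *)
Lemma smooth_on_invmx n (U : set E) (M : E -> 'M[R]_n) :
  open U -> smooth_on U M -> (forall y, U y -> M y \in unitmx) ->
  smooth_on U (fun y => invmx (M y)).
Proof.
move=> oU sM uM; apply: smooth_on_matrix => // i j.
apply: (@smooth_on_eq _ _ _ _ oU
  (fun y => (\det (M y))^-1 * cofactor (M y) j i)).
  by move=> y /uM uy; rewrite /invmx uy !mxE.
apply: smooth_on_mul => //.
  apply: smooth_on_inv => //; first exact: smooth_on_det.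
  by move=> y /uM; rewrite unitmxE unitfE.
rewrite /cofactor; apply: smooth_on_mul => //; first exact: smooth_on_cst.
apply: smooth_on_det => //; apply: smooth_on_matrix => // k l.
apply: (@smooth_on_eq _ _ _ _ oU (fun y => M y (lift j k) (lift i l))).
  by move=> y _; rewrite !mxE.
exact: smooth_on_entry.
Qed.

Lemma smooth_on_derivable (F : normedModType R) (U : set E) (h : E -> F) x v :
  smooth_on U h -> U x -> derivable h x v.
Proof. by move=> sh Ux; apply: diff_derivable; exact: smooth_on_differentiable Ux. Qed.

End MatrixCalculus.

Definition mx_comm (R : realType) (n : nat) (a b : 'M[R]_n) : 'M[R]_n :=
  a *m b - b *m a.

Lemma mx_commE (R : realType) (n : nat) (a b : 'M[R]_n) i j :
  mx_comm a b i j = \sum_m a i m * b m j - \sum_m b i m * a m j.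
Proof. by rewrite !mxE. Qed.

(** * Connections and the Koszul formula *)
Section Connection.
Variables (R : realType) (E : normedModType R) (T : Type) (A : atlas T E).
Variables (D : chart A -> (E -> E) -> (E -> E) -> E -> E) (hD : is_connection D).
Variables (c : chart A) (W : set E) (oW : open W) (Wc : W `<=` chart_im c).

Lemma conn0r X : smooth_on W X -> forall y, W y -> D c X (fun=> 0) y = 0.
Proof.
move=> sX y Wy.
have s0 : smooth_on W (fun=> 0 : E) by exact: smooth_on_cst.
have := conn_addr hD oW Wc sX s0 s0 Wy.
have -> : (fun z : E => 0 + 0) = (fun=> 0 : E) by apply/funext => z; rewrite addr0.
by move=> /eqP; rewrite -subr_eq subrr eq_sym => /eqP.
Qed.

Lemma conn0l X : smooth_on W X -> forall y, W y -> D c (fun=> 0) X y = 0.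
Proof.
move=> sX y Wy.
have s0 : smooth_on W (fun=> 0 : E) by exact: smooth_on_cst.
have := conn_addl hD oW Wc s0 s0 sX Wy.
have -> : (fun z : E => 0 + 0) = (fun=> 0 : E) by apply/funext => z; rewrite addr0.
by move=> /eqP; rewrite -subr_eq subrr eq_sym => /eqP.
Qed.

Lemma conn_sumr (I : Type) (r : seq I) X (Y : I -> E -> E) :
  smooth_on W X -> (forall i, smooth_on W (Y i)) -> forall y, W y ->
  D c X (fun z => \sum_(i <- r) Y i z) y = \sum_(i <- r) D c X (Y i) y.
Proof.
move=> sX sY y Wy.
have sS s : smooth_on W (fun z => \sum_(i <- s) Y i z).
  elim: s => [|i s IH].
    have -> : (fun z => \sum_(i <- [::]) Y i z) = cst 0.
      by apply/funext => z; rewrite big_nil.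
    exact: smooth_on_cst.
  have -> : (fun z => \sum_(j <- i :: s) Y j z) =
      (fun z => Y i z + \sum_(j <- s) Y j z).
    by apply/funext => z; rewrite big_cons.
  exact: smooth_on_add.
elim: r => [|i s IH].
  rewrite big_nil; have -> : (fun z => \sum_(i <- [::]) Y i z) = fun=> 0.
    by apply/funext => z; rewrite big_nil.
  exact: conn0r.
rewrite big_cons -IH -(conn_addr hD oW Wc sX (sY i) (sS s) Wy).
congr (D c X _ y); by apply/funext => z; rewrite big_cons.
Qed.

End Connection.

Section Koszul.
Variables (R : realType) (E : normedModType R) (T : Type) (A : atlas T E).
Variables (G : chart A -> E -> E -> E -> R) (hG : riemannian_metric G).
Variables (D : chart A -> (E -> E) -> (E -> E) -> E -> E) (hD : levi_civita G D).

Lemma metric_addl c y u u' v : chart_im c y ->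
  G c y (u + u') v = G c y u v + G c y u' v.
Proof. by move=> Wy; rewrite -{1}[u]scale1r (rm_linear hG) // mul1r. Qed.

Lemma metric0l c y v : chart_im c y -> G c y 0 v = 0.
Proof.
by move=> Wy; apply: (@addrI _ (G c y 0 v)); rewrite -metric_addl // !addr0.
Qed.

Lemma metric_scalel c y a u v : chart_im c y -> G c y (a *: u) v = a * G c y u v.
Proof. by move=> Wy; rewrite -[a *: u]addr0 (rm_linear hG) // metric0l // addr0. Qed.

Lemma metric_subl c y u u' v : chart_im c y ->
  G c y (u - u') v = G c y u v - G c y u' v.
Proof.
by move=> Wy; rewrite metric_addl // -scaleN1r metric_scalel // mulN1r.
Qed.

Lemma metric_suml (I : Type) (r : seq I) c y (u : I -> E) v : chart_im c y ->
  G c y (\sum_(i <- r) u i) v = \sum_(i <- r) G c y (u i) v.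
Proof.
move=> Wy; elim: r => [|i r IH]; first by rewrite !big_nil metric0l.
by rewrite !big_cons metric_addl // IH.
Qed.

(** Metric compatibility, used for the three choices of the differentiated
    pair, involves six products of a covariant derivative with a field; the
    absence of torsion cancels all but one of them, which appears twice. *)
Lemma koszul c (W : set E) X Y Z y : open W -> W `<=` chart_im c ->
  smooth_on W X -> smooth_on W Y -> smooth_on W Z -> W y ->
  2 * G c y (D c X Y y) (Z y) =
    'D_(X y) (fun z => G c z (Y z) (Z z)) y
    + 'D_(Y y) (fun z => G c z (X z) (Z z)) y
    - 'D_(Z y) (fun z => G c z (X z) (Y z)) y
    + G c y (lie_bracket X Y y) (Z y)
    - G c y (lie_bracket X Z y) (Y y)
    - G c y (lie_bracket Y Z y) (X y).
Proof.
move=> oW Wc sX sY sZ Wy; have cy := Wc _ Wy.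
rewrite (lc_metric hD oW Wc sX sY sZ Wy) (lc_metric hD oW Wc sY sX sZ Wy).
rewrite (lc_metric hD oW Wc sZ sX sY Wy).
rewrite -(lc_torsion_free hD oW Wc sX sY Wy) -(lc_torsion_free hD oW Wc sX sZ Wy).
rewrite -(lc_torsion_free hD oW Wc sY sZ Wy) !metric_subl //.
rewrite (rm_sym hG (Y y) (D c X Z y) cy) (rm_sym hG (X y) (D c Y Z y) cy).
rewrite (rm_sym hG (X y) (D c Z Y y) cy).
move: (G c y _ _) (G c y _ _) (G c y _ _) (G c y _ _) (G c y _ _) (G c y _ _).
by move=> *; ring.
Qed.

End Koszul.

(** * The curvature of the base in matrix form *)
Section Base.
Variables (R : realType) (n : nat) (M : topologicalType) (A : atlas M 'rV[R]_n).
Hypothesis hM : smooth_manifold A.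
Variable g : chart A -> 'rV[R]_n -> 'rV[R]_n -> 'rV[R]_n -> R.
Hypothesis hg : riemannian_metric g.
Variable D : chart A -> ('rV[R]_n -> 'rV[R]_n) -> ('rV[R]_n -> 'rV[R]_n) ->
  'rV[R]_n -> 'rV[R]_n.
Hypothesis hD : levi_civita g D.
Variable c : chart A.

Local Notation E := 'rV[R]_n.
Local Notation e := (basis_vec R).
Local Notation W := (chart_im c).
Local Notation Gam := (christoffel D c).

Lemma chart_im_open (d : chart A) : open (chart_im d).
Proof. by apply/(mfd_homeo hM (@subset_refl _ _)); exact: mfd_dom_open. Qed.
Let oW : open W := @chart_im_open c.
Let Wc : W `<=` W := @subset_refl _ W.

Definition gram (y : E) : 'M[R]_n := \matrix_(i, j) glow g c y i j.

(** The connection matrix in the direction k: the upper index is the row, so that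
    the matrix acts on columns of components. *)
Definition christoffel_mx (k : 'I_n) (y : E) : 'M[R]_n :=
  \matrix_(s, j) Gam y k j s.
Local Notation Gm := christoffel_mx.

Lemma smooth_coord_field (i : 'I_n) (U : set E) : open U ->
  smooth_on U (@coord_field R n i).
Proof. by move=> oU; exact: smooth_on_cst. Qed.
Let sf i := smooth_coord_field i oW.

Lemma christoffel_sym y i j h : W y -> Gam y i j h = Gam y j i h.
Proof.
move=> Wy; have := lc_torsion_free hD oW Wc (sf i) (sf j) Wy.
rewrite /lie_bracket !derive_cst subr0 => /eqP; rewrite subr_eq0 => /eqP ij.
by rewrite /christoffel ij.
Qed.

Lemma smooth_christoffel i j h : smooth_on W (fun y => Gam y i j h).
Proof.
by apply: smooth_on_entry => //; apply: (conn_smooth (lc_connection hD)).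
Qed.

Lemma smooth_christoffel_mx k : smooth_on W (Gm k).
Proof.
apply: smooth_on_matrix => // i j.
apply: (smooth_on_eq oW _ (smooth_christoffel k j i)) => y _.
by rewrite mxE.
Qed.

Lemma conn_coord y l j : D c (@coord_field R n l) (@coord_field R n j) y =
  \sum_s Gam y l j s *: e s.
Proof. by rewrite {1}[D _ _ _ _]row_sum_delta. Qed.

Lemma metric_gramE y (u v : E) : W y ->
  g c y u v = (u *m gram y *m v^T) 0 0.
Proof.
move=> Wy.
have expand a b : g c y a b = \sum_i a 0 i * g c y (e i) b.
  rewrite {1}[a]row_sum_delta (metric_suml hg) //.
  by apply: eq_bigr => i _; rewrite (metric_scalel hg).
rewrite (rm_sym hg _ _ Wy) expand [RHS]mxE; apply: eq_bigr => j _.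
rewrite [v^T j 0]mxE mulrC; congr (_ * _).
rewrite (rm_sym hg _ _ Wy) expand mxE; apply: eq_bigr => i _.
by rewrite [gram y i j]mxE.
Qed.

Lemma gram_sym y : W y -> (gram y)^T = gram y.
Proof.
by move=> Wy; apply/matrixP => i j; rewrite !mxE /glow (rm_sym hg _ _ Wy).
Qed.

(** A vector in the kernel of the Gram matrix would be orthogonal to itself. *)
Lemma gram_unit y : W y -> gram y \in unitmx.
Proof.
move=> Wy; rewrite -row_free_unit -kermx_eq0; apply/negPn/negP.
move=> /rowV0Pn [v /sub_kermxP vg v0].
have := rm_pos hg Wy v0.
by rewrite metric_gramE // vg mul0mx mxE ltxx.
Qed.

Lemma smooth_glow i j : smooth_on W (fun y => glow g c y i j).
Proof. exact: rm_smooth hg _ _ _. Qed.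

Lemma smooth_gram : smooth_on W gram.
Proof.
apply: smooth_on_matrix => // i j.
apply: (@smooth_on_eq _ _ _ _ oW (fun y => glow g c y i j)).
  by move=> y _; rewrite mxE.
exact: smooth_glow.
Qed.

Definition gram_inv (y : E) : 'M[R]_n := invmx (gram y).

Lemma smooth_gram_inv : smooth_on W gram_inv.
Proof. by apply: smooth_on_invmx => //; [exact: smooth_gram|exact: gram_unit]. Qed.

Lemma gram_inv_sym y : W y -> (gram_inv y)^T = gram_inv y.
Proof. by move=> Wy; rewrite /gram_inv trmx_inv gram_sym. Qed.

Lemma derive_glow y k i j : W y ->
  'D_(e k) (fun z => glow g c z i j) y =
  \sum_m Gam y k i m * glow g c y m j + \sum_m Gam y k j m * glow g c y i m.
Proof.
move=> Wy.
have := lc_metric hD oW Wc (sf k) (sf i) (sf j) Wy.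
rewrite /coord_field => ->; congr (_ + _).
  rewrite -[LHS]/(g c y (D c (@coord_field R n k) (@coord_field R n i) y) (e j)).
  rewrite (rm_sym hg _ _ Wy) metric_gramE // mxE.
  by apply: eq_bigr => m _; rewrite -rowE !mxE mulrC /glow (rm_sym hg _ _ Wy).
rewrite -[LHS]/(g c y (e i) (D c (@coord_field R n k) (@coord_field R n j) y)).
rewrite metric_gramE // mxE.
by apply: eq_bigr => m _; rewrite -rowE !mxE mulrC.
Qed.

Lemma derive_gram y k : W y ->
  'D_(e k) gram y = (Gm k y)^T *m gram y + gram y *m Gm k y.
Proof.
move=> Wy; rewrite derive_mx; last exact: smooth_on_derivable smooth_gram Wy.
apply/matrixP => i j; rewrite 3!mxE [in RHS]mxE.
have -> : (fun z => gram z i j) = (fun z => glow g c z i j).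
  by apply/funext => z; rewrite mxE.
rewrite derive_glow //; congr (_ + _); apply: eq_bigr => m _; rewrite !mxE //.
exact: mulrC.
Qed.

(** Differentiate g^-1 g = 1. *)
Lemma derive_gram_inv y k : W y ->
  'D_(e k) gram_inv y = - (gram_inv y *m (Gm k y)^T + Gm k y *m gram_inv y).
Proof.
move=> Wy.
have dg := smooth_on_derivable (v := e k) smooth_gram Wy.
have di := smooth_on_derivable (v := e k) smooth_gram_inv Wy.
have := derive_mulmx di dg.
rewrite (@derive_eq_on _ _ _ _ oW _ (cst 1%:M) (e k) _ y Wy); last first.
  by move=> z Wz; rewrite mulVmx //; exact: gram_unit.
rewrite derive_cst => /esym/eqP; rewrite addr_eq0 => /eqP.
move=> /(congr1 (mulmx^~ (gram_inv y))); rewrite mulmxK ?gram_unit // => ->.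
rewrite derive_gram // mulmxDr mulmxA mulKmx ?gram_unit //.
by rewrite mulNmx mulmxDl mulmxK ?gram_unit.
Qed.

(** The curvature form d Gam + Gam /\ Gam on the pair of coordinate directions
    (k, l); its entry in row s and column j is R_{klj}^s. *)
Definition curvature_mx (k l : 'I_n) (y : E) : 'M[R]_n :=
  'D_(e k) (Gm l) y - 'D_(e l) (Gm k) y + (Gm k y *m Gm l y - Gm l y *m Gm k y).

Lemma derive_christoffel_mx k l y s j : W y ->
  'D_(e k) (Gm l) y s j = 'D_(e k) (fun z => Gam z l j s) y.
Proof.
move=> Wy.
rewrite derive_mx; last exact: smooth_on_derivable (smooth_christoffel_mx l) Wy.
rewrite mxE; have -> : (fun z => Gm l z s j) = (fun z => Gam z l j s) => //.
by apply/funext => z; rewrite mxE.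
Qed.

Lemma conn_conn_coord y k l j s : W y ->
  D c (@coord_field R n k) (D c (@coord_field R n l) (@coord_field R n j)) y 0 s =
  ('D_(e k) (Gm l) y + Gm k y *m Gm l y) s j.
Proof.
move=> Wy.
have -> : D c (@coord_field R n l) (@coord_field R n j) =
    (fun z => \sum_s Gam z l j s *: @coord_field R n s z).
  by apply/funext => z; rewrite conn_coord.
have sY i : smooth_on W (fun z => Gam z l j i *: @coord_field R n i z).
  by apply: smooth_on_scale => //; exact: smooth_christoffel.
rewrite (conn_sumr (lc_connection hD) oW Wc) //.
rewrite summxE [RHS]mxE derive_christoffel_mx // mxE.
under eq_bigr => i _ do
  rewrite (conn_leibniz (lc_connection hD) oW Wc
      (smooth_christoffel l j i) (sf k) (sf i) Wy)
    mxE mxE [in X in _ + X]mxE.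
rewrite big_split /=; congr (_ + _).
  rewrite (bigD1 s) //= big1 ?addr0 => [|i si].
    by rewrite /coord_field !mxE !eqxx mulr1.
  by rewrite /coord_field !mxE [s == i]eq_sym (negPf si) mulr0.
by apply: eq_bigr => i _; rewrite !mxE mulrC.
Qed.

Lemma riemE y k l j s : W y -> riem D c y k l j s = curvature_mx k l y s j.
Proof.
move=> Wy; rewrite /riem /curvature 2!mxE [(- D _ _ _ _) 0 s]mxE [X in _ - _ + X]mxE.
have -> : lie_bracket (@coord_field R n k) (@coord_field R n l) = fun=> 0.
  by apply/funext => z; rewrite /lie_bracket !derive_cst subr0.
rewrite (conn0l (lc_connection hD) oW Wc) // !conn_conn_coord // /curvature_mx.
set a := 'D_(e k) _ _; set b := 'D_(e l) _ _; set p := _ *m _; set q := _ *m _.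
by clearbody a b p q; rewrite !mxE; ring.
Qed.

Lemma curvature_mx_anti k l y : curvature_mx l k y = - curvature_mx k l y.
Proof. by rewrite /curvature_mx opprD !opprB. Qed.

Lemma curvature_mxE k l y s j : curvature_mx k l y s j =
  'D_(e k) (Gm l) y s j - 'D_(e l) (Gm k) y s j
  + ((Gm k y *m Gm l y) s j - (Gm l y *m Gm k y) s j).
Proof.
rewrite {1}/curvature_mx.
set a := 'D_(e k) _ _; set b := 'D_(e l) _ _; set p := _ *m _; set q := _ *m _.
by rewrite !mxE.
Qed.

Lemma cyclic_cancel (a b d p q r a' b' d' p' q' r' : R) :
  a = a' -> b = b' -> d = d' -> p = p' -> q = q' -> r = r' ->
  (a - b + (p - q)) + (b' - d + (q' - r)) + (d' - a' + (r' - p')) = 0.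
Proof. by do 6 move=> ->; ring. Qed.

(** Both the derivatives and the products of connection matrices cancel in pairs
    because the Christoffel symbols are symmetric in their lower indices. *)
Lemma bianchi y k l j s : W y ->
  curvature_mx k l y s j + curvature_mx l j y s k + curvature_mx j k y s l = 0.
Proof.
move=> Wy.
have dsym a b d : 'D_(e a) (Gm b) y s d = 'D_(e a) (Gm d) y s b.
  rewrite (derive_christoffel_mx a b s d Wy) (derive_christoffel_mx a d s b Wy).
  apply: (derive_eq_on oW) Wy => z Wz; exact: christoffel_sym.
have psym a b d : (Gm a y *m Gm b y) s d = (Gm a y *m Gm d y) s b.
  rewrite !mxE; apply: eq_bigr => i _; rewrite !mxE; congr (_ * _).
  exact: christoffel_sym.
rewrite (curvature_mxE k l) (curvature_mxE l j) (curvature_mxE j k).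
by apply: cyclic_cancel; do [exact: dsym | exact: psym].
Qed.

(** The hypothesis is the equality of d_k (d_l g) and d_l (d_k g) after two uses
    of d_k g = Gam_k^T g + g Gam_k, where p and q are Gam_k and Gam_l, and a and
    b are d_k Gam_l and d_l Gam_k; the conclusion is that g R_kl is skew. *)
Lemma skew_of_second_derivatives (a b p q h : 'M[R]_n) :
  a^T *m h + h *m a + (q^T *m (p^T *m h + h *m p) + (p^T *m h + h *m p) *m q) =
  b^T *m h + h *m b + (p^T *m (q^T *m h + h *m q) + (q^T *m h + h *m q) *m p) ->
  (a - b + (p *m q - q *m p))^T *m h + h *m (a - b + (p *m q - q *m p)) = 0.
Proof.
have -> : (a - b + (p *m q - q *m p))^T = a^T - b^T + (q^T *m p^T - p^T *m q^T).
  by rewrite -!trmx_mul; apply/matrixP => i j;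
    move: (p *m q) (q *m p) => u v; rewrite !mxE.
rewrite !(mulmxDl, mulmxDr, mulNmx, mulmxN) !mulmxA.
move: (a^T *m h) (h *m a) (b^T *m h) (h *m b) => a1 a2 b1 b2.
move: (q^T *m p^T *m h) (q^T *m h *m p) (p^T *m h *m q) (h *m p *m q)
  (p^T *m q^T *m h) (h *m q *m p) => t1 t2 t3 t4 t5 t6 /matrixP eq_ij.
by apply/matrixP => i j; have := eq_ij i j; rewrite !mxE => ?; lra.
Qed.

(** Skewness of g R_kl: the second derivatives of g commute. *)
Lemma curvature_gram y k l : W y ->
  (curvature_mx k l y)^T *m gram y + gram y *m curvature_mx k l y = 0.
Proof.
move=> Wy.
have dg v : derivable gram y v by exact: smooth_on_derivable smooth_gram Wy.
have dG i v : derivable (Gm i) y v.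
  exact: smooth_on_derivable (smooth_christoffel_mx i) Wy.
have second a b : 'D_(e a) ('D_(e b) gram) y =
    ('D_(e a) (Gm b) y)^T *m gram y + gram y *m 'D_(e a) (Gm b) y
    + ((Gm b y)^T *m ((Gm a y)^T *m gram y + gram y *m Gm a y)
       + ((Gm a y)^T *m gram y + gram y *m Gm a y) *m Gm b y).
  rewrite (derive_eq_on oW (e a) (fun z Wz => derive_gram b Wz) Wy).
  rewrite (@deriveD _ _ _ (fun z => (Gm b z)^T *m gram z) (fun z => gram z *m Gm b z));
    [|exact: derivable_mulmx (derivable_trmx _) _|exact: derivable_mulmx].
  rewrite !derive_mulmx ?derive_trmx //; last exact: derivable_trmx.
  rewrite derive_gram // -!addrA; congr (_ + _).
  by rewrite [RHS]addrCA; congr (_ + _); rewrite addrC.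
have sym : 'D_(e k) ('D_(e l) gram) y = 'D_(e l) ('D_(e k) gram) y.
  have sdg v : smooth_on W ('D_v gram) by exact: smooth_on_derive smooth_gram.
  apply: etrans (derive_mx (smooth_on_derivable (v := e k) (sdg (e l)) Wy)) _.
  apply: etrans _ (esym (derive_mx (smooth_on_derivable (v := e l) (sdg (e k)) Wy))).
  apply/matrixP => i j; rewrite [LHS]mxE [RHS]mxE.
  have entry v z : W z -> 'D_v gram z i j = 'D_v (fun y => gram y i j) z.
    by move=> Wz; rewrite (derive_mx (smooth_on_derivable smooth_gram Wz)) mxE.
  have second_entry a b : 'D_(e a) (fun z => 'D_(e b) gram z i j) y =
      'D_(e a) ('D_(e b) (fun y => gram y i j)) y.
    exact: (derive_eq_on oW (e a) (entry (e b)) Wy).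
  apply: etrans (second_entry k l) (etrans _ (esym (second_entry l k))).
  apply: (schwarz _ _ oW) Wy; apply: smooth_on_entry oW _; exact: smooth_gram.
apply: skew_of_second_derivatives.
exact: etrans (esym (second k l)) (etrans sym (second l k)).
Qed.

(** In a signed sum of the four cyclic identities, one for each index that stays
    fixed, the skew-symmetries cancel all but the two terms compared. *)
Lemma pair_symmetry_of_bianchi (L : 'I_n -> 'I_n -> 'I_n -> 'I_n -> R) :
  (forall k l j s, L l k j s = - L k l j s) ->
  (forall k l j s, L k l s j = - L k l j s) ->
  (forall k l j s, L k l j s + L l j k s + L j k l s = 0) ->
  forall k l j s, L k l j s = L j s k l.
Proof.
move=> a12 a34 b k l j s.
have := b k l j s; have := b l j s k; have := b j s k l; have := b s k l j.
have signs p q r t : [/\ L q p r t = - L p q r t, L p q t r = - L p q r t &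
    L q p t r = L p q r t].
  by rewrite (a34 q p r t) (a12 p q r t) (a34 p q r t) opprK.
have [? ? ?] := signs k l j s; have [? ? ?] := signs j s k l.
have [? ? ?] := signs k j l s; have [? ? ?] := signs l s k j.
have [? ? ?] := signs k s l j; have [? ? ?] := signs l j k s.
lra.
Qed.

Lemma curvature_pair_sym y k l j s : W y ->
  (gram y *m curvature_mx k l y) s j = (gram y *m curvature_mx j s y) l k.
Proof.
move=> Wy; apply: (@pair_symmetry_of_bianchi
  (fun k l j s => (gram y *m curvature_mx k l y) s j)) => {k l j s} k l j s /=.
- by rewrite (curvature_mx_anti k l) mulmxN mxE.
- move/eqP: (curvature_gram k l Wy); rewrite addrC addr_eq0 => /eqP {1}->.
  by rewrite -{1}(gram_sym Wy) -trmx_mul mxE mxE.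
- rewrite !mxE -!big_split /= big1 // => m _.
  by rewrite -!mulrDr bianchi ?mulr0.
Qed.

Local Notation Rm := curvature_mx.
Local Notation gm := gram.
Local Notation gi := gram_inv.
Local Notation gl := (glow g c).

Variables (f : M -> R) (hf : smooth_fun A f).
Local Notation fe := (chart_expr c f).

(** * Lowering indices *)
Lemma sum_kronecker (j : 'I_n) (h : 'I_n -> R) : \sum_r (j == r)%:R * h r = h j.
Proof.
rewrite (bigD1 j) //= big1 => [|r rj]; first by rewrite eqxx mul1r addr0.
by rewrite eq_sym (negPf rj) mul0r.
Qed.

Lemma glow_sym y i j : W y -> gl y i j = gl y j i.
Proof. by move=> Wy; rewrite /glow (rm_sym hg _ _ Wy). Qed.

Lemma derive_scaled_glow y a i j : W y ->
  'D_(e a) (fun y => fe y * gl y i j) y =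
  fe y * (\sum_r Gam y a i r * gl y r j + \sum_r Gam y a j r * gl y r i)
  + gl y i j * grad_low f c y a.
Proof.
move=> Wy.
have df : derivable fe y (e a) := smooth_on_derivable (hf (c := c)) Wy.
have dg : derivable (fun z => gl z i j) y (e a).
  have sg : smooth_on W (fun z => gl z i j) := smooth_glow i j.
  exact: smooth_on_derivable sg Wy.
have := deriveM df dg; rewrite (derive_glow a i j Wy) => DE.
apply: etrans DE _; congr (_ * (_ + _) + _).
by apply: eq_bigr => m _; rewrite (glow_sym _ _ Wy).
Qed.

Lemma lower_grad_up y k : W y ->
  \sum_r grad_up g f c y r * gl y r k = grad_low f c y k.
Proof.
move=> Wy.
have gig : gi y *m gm y = 1%:M by rewrite mulVmx // (gram_unit).
under eq_bigr => r _ do rewrite mulr_suml.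
rewrite exchange_big /= -[RHS](sum_kronecker k); apply: eq_bigr => m _.
have <- : (gi y *m gm y) m k = (k == m)%:R by rewrite gig mxE eq_sym.
rewrite mxE mulr_suml; apply: eq_bigr => r _; rewrite mxE.
have -> : gup g c y r m = gi y m r by rewrite -(gram_inv_sym Wy) mxE.
ring.
Qed.

(** Lowering the upper index of the tensor A gives the derivatives of f in the
    Koszul formula for f g. *)
Lemma lower_fA y l j k : W y ->
  \sum_r fA g f c y l j r * gl y r k =
  grad_low f c y l * gl y j k + grad_low f c y j * gl y l k
  - grad_low f c y k * gl y l j.
Proof.
move=> Wy.
transitivity (\sum_r (grad_low f c y l * ((j == r)%:R * gl y r k)
    + grad_low f c y j * ((l == r)%:R * gl y r k)
    - grad_up g f c y r * gl y r k * gl y l j)).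
  apply: eq_bigr => r _; rewrite /fA.
  by move: (grad_low _ _ _ l) (grad_low _ _ _ j) (grad_up _ _ _ _ _) => *; ring.
by rewrite sumrB big_split -!mulr_sumr -mulr_suml /= !sum_kronecker lower_grad_up.
Qed.

(** The Christoffel symbols of the conformal metric f g: among the six terms
    coming from the derivatives of g, four cancel and the other two are equal,
    while the derivatives of f make up the tensor A with its index lowered. *)
Lemma scaled_koszul y l j k : W y -> fe y != 0 ->
  'D_(e l) (fun y => fe y * gl y j k) y + 'D_(e j) (fun y => fe y * gl y l k) y
  - 'D_(e k) (fun y => fe y * gl y l j) y =
  2 * (fe y * \sum_r (Gam y l j r + (2 * fe y)^-1 * fA g f c y l j r) * gl y r k).
Proof.
move=> Wy f0.
rewrite (derive_scaled_glow l j k Wy) (derive_scaled_glow j l k Wy).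
rewrite (derive_scaled_glow k l j Wy).
have sym a b d : \sum_r Gam y a b r * gl y r d = \sum_r Gam y b a r * gl y r d.
  by apply: eq_bigr => r _; rewrite (christoffel_sym).
rewrite (sym j l) (sym k l) (sym k j).
have -> : \sum_r (Gam y l j r + (2 * fe y)^-1 * fA g f c y l j r) * gl y r k =
    \sum_r Gam y l j r * gl y r k + (2 * fe y)^-1 *
    \sum_r fA g f c y l j r * gl y r k.
  rewrite mulr_sumr -big_split; apply: eq_bigr => r _ /=; ring.
rewrite lower_fA //.
move: (\sum_r _) (\sum_r _) (\sum_r _) => a b d.
move: (grad_low _ _ _ _) (grad_low _ _ _ _) (grad_low _ _ _ _).
move: (gl y j k) (gl y l k) (gl y l j) => *.
by field.
Qed.

(** Multiply the skewness of g R_kl by g^-1 on both sides. *)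
Lemma curvature_gram_inv y k l : W y ->
  Rm k l y *m gi y = - (gi y *m (Rm k l y)^T).
Proof.
move=> Wy; have gu := gram_unit Wy.
have := curvature_gram k l Wy => /(congr1 (fun N => gi y *m N *m gi y)).
rewrite mulmx0 mul0mx mulmxDr mulmxDl !mulmxA mulmxK // mulVmx // mul1mx.
by rewrite addrC => /eqP; rewrite addr_eq0 => /eqP.
Qed.

Lemma gram_curvature_anti y k l i j : W y ->
  (gm y *m Rm k l y) i j = - (gm y *m Rm k l y) j i.
Proof.
move=> Wy; have /eqP := curvature_gram k l Wy.
rewrite addrC addr_eq0 => /eqP {1}->.
by rewrite -{1}(gram_sym Wy) -trmx_mul mxE mxE.
Qed.

(** The symmetry R_{ablk} = R_{lkab} moves the free index k into the first pair,
    so that the curvature enters through the single matrix R_lk. *)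
Lemma lower_riem y a b l k : W y ->
  \sum_r riem D c y a b l r * gl y r k = (gm y *m Rm l k y) b a.
Proof.
move=> Wy; rewrite -(curvature_pair_sym a b l k Wy) mxE.
apply: eq_bigr => r _; rewrite (riemE _ _ _ _ Wy) [gm y k r]mxE (glow_sym r k Wy).
exact: mulrC.
Qed.

(** After the exchange of pairs one of the two raised indices undoes a lowering;
    the sign comes from the skewness of R_lk g^-1. *)
Lemma lower_riem_up y s j l k : W y ->
  \sum_r riem_up g D c y s j l r * gl y r k = - (Rm l k y *m gi y) s j.
Proof.
move=> Wy.
have -> : - (Rm l k y *m gi y) s j = (Rm l k y *m gi y) j s.
  rewrite {1}(curvature_gram_inv l k Wy) -{1}(gram_inv_sym Wy) -trmx_mul.
  by rewrite mxE opprK mxE.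
rewrite -[Rm l k y](mulKmx (gram_unit Wy)) [RHS]mxE.
under eq_bigr => r _ do rewrite mulr_suml.
rewrite exchange_big; apply: eq_bigr => a _ /=.
under eq_bigr => r _ do rewrite mulr_suml.
rewrite exchange_big mxE mulr_suml; apply: eq_bigr => b _ /=.
rewrite -(lower_riem a b l k Wy) mulr_sumr mulr_suml; apply: eq_bigr => r _.
have -> : gup g c y b j = gi y j b by rewrite -(gram_inv_sym Wy) mxE.
by rewrite -[gup g c y a s]/(gi y a s); ring.
Qed.

(** The two sums are the two products in the commutator [t, R_lk]. *)
Lemma lower_mixed y (t : 'M[R]_n) i j l k : W y -> fe y != 0 ->
  2 * (fe y * \sum_(r < n)
    ((2 * fe y)^-1 *
       (\sum_(a < n) \sum_(s < n) gl y i a * riem_up g D c y s j l r * t a s)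
     - (2 * fe y)^-1 *
       (\sum_(b < n) \sum_(s < n) gup g c y j b * riem D c y i s l r * t s b))
     * gl y r k)
  = - (gm y *m mx_comm t (Rm l k y) *m gi y) i j.
Proof.
move=> Wy f0.
have first_part : \sum_r (\sum_(a < n) \sum_(s < n)
    gl y i a * riem_up g D c y s j l r * t a s) * gl y r k =
    - (gm y *m t *m (Rm l k y *m gi y)) i j.
  under eq_bigr => r _ do rewrite mulr_suml.
  rewrite exchange_big /= mxE -sumrN.
  transitivity (\sum_a \sum_s gl y i a * t a s * - (Rm l k y *m gi y) s j).
    apply: eq_bigr => a _; under eq_bigr => r _ do rewrite mulr_suml.
    rewrite exchange_big /=; apply: eq_bigr => s _.
    rewrite -(lower_riem_up s j l k Wy) mulr_sumr; apply: eq_bigr => r _; ring.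
  rewrite exchange_big /=; apply: eq_bigr => s _.
  rewrite [(gm y *m t) i s]mxE -mulrN mulr_suml; apply: eq_bigr => a _.
  by rewrite [gm y i a]mxE.
have second_part : \sum_r (\sum_(b < n) \sum_(s < n)
    gup g c y j b * riem D c y i s l r * t s b) * gl y r k =
    - (gm y *m Rm l k y *m (t *m gi y)) i j.
  under eq_bigr => r _ do rewrite mulr_suml.
  rewrite exchange_big /= mxE -sumrN.
  transitivity (\sum_b \sum_s gi y b j * t s b * - (gm y *m Rm l k y) i s).
    apply: eq_bigr => b _; under eq_bigr => r _ do rewrite mulr_suml.
    rewrite exchange_big /=; apply: eq_bigr => s _.
    rewrite -(gram_curvature_anti l k s i Wy) -(lower_riem i s l k Wy) mulr_sumr.
    apply: eq_bigr => r _.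
    have -> : gup g c y j b = gi y b j by rewrite -(gram_inv_sym Wy) mxE.
    ring.
  rewrite exchange_big /=; apply: eq_bigr => s _.
  rewrite [(t *m _) s j]mxE mulr_sumr -sumrN; apply: eq_bigr => b _; ring.
have -> : gm y *m mx_comm t (Rm l k y) *m gi y =
    gm y *m t *m (Rm l k y *m gi y) - gm y *m Rm l k y *m (t *m gi y).
  by rewrite /mx_comm mulmxBr mulmxBl !mulmxA.
set P := gm y *m t *m _; set Q := _ *m (t *m _).
have -> : - (P - Q) i j = - P i j + Q i j by rewrite !mxE opprB addrC.
under eq_bigr => r _ do rewrite -mulrBr -mulrA mulrBl.
rewrite -mulr_sumr sumrB first_part second_part.
by rewrite -/P -/Q; move: (P i j) (Q i j) => u v; field.
Qed.

End Base.

(** * Charts of the tensor bundle *)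
Lemma chain_rule_coord (R : realType) (n : nat) (F F' : normedModType R)
    (phi : F -> 'rV[R]_n) (psi : 'rV[R]_n -> F') x y v : phi x = y ->
  differentiable phi x -> differentiable psi y ->
  'D_v (psi \o phi) x = \sum_k 'D_v phi x 0 k *: 'D_(basis_vec R k) psi y.
Proof.
move=> <- dphi dpsi.
rewrite (deriveE _ (differentiable_comp dphi dpsi)) (diff_comp dphi dpsi) /=.
rewrite (deriveE v dphi) {1}['d phi x v]row_sum_delta linear_sum.
by apply: eq_bigr => k _; rewrite linearZ /= (deriveE (basis_vec R k) dpsi).
Qed.

Section TensorCharts.
Variables (R : realType) (n : nat) (M : topologicalType) (A : atlas M 'rV[R]_n).
Hypothesis hM : smooth_manifold A.
Local Notation e := (basis_vec R).

Lemma chart_expr_map (F : zmodType) (c : chart A) (h : M -> F) p :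
  chart_dom c p -> chart_expr c h (chart_map c p) = h p.
Proof.
move=> cp; apply: xget_unique; first by exists p.
move=> _ [q [cq qp] <-]; congr h.
by apply: (mfd_inj hM (c := c)); rewrite ?inE.
Qed.

Lemma chart_trans_differentiable c d p : chart_dom c p -> chart_dom d p ->
  differentiable (chart_trans (A := A) c d) (chart_map c p).
Proof.
move=> cp dp. have scd : smooth_on (chart_overlap c d) (chart_trans c d).
  exact: mfd_smooth hM _ _.
apply: (smooth_on_differentiable scd).
by exists p. 
Qed.

Lemma near_chart (c : chart A) p (U : set M) : open U -> chart_dom c p -> U p ->
  \forall y \near chart_map c p, (chart_map c @` (chart_dom c `&` U)) y.
Proof.
move=> oU cp Up; apply: open_nbhs_nbhs; split; last by exists p.
apply/(mfd_homeo hM); first exact: subIsetl.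
by apply: openI => //; exact: mfd_dom_open hM c.
Qed.

Definition jacobian_mx (c d : chart A) (y : 'rV[R]_n) : 'M[R]_n :=
  \matrix_(a, i) chart_jac c d y a i.

(** On the triple overlap the transition map from c to d' is the composite of the
    other two, so this is the chain rule at p. *)
Lemma jacobian_mx_cocycle c d d' p : chart_dom c p -> chart_dom d p ->
  chart_dom d' p ->
  jacobian_mx d d' (chart_map d p) *m jacobian_mx c d (chart_map c p) =
  jacobian_mx c d' (chart_map c p).
Proof.
move=> cp dp d'p; apply/matrixP => a i; rewrite [LHS]mxE [RHS]mxE.
have cdE : chart_trans c d (chart_map c p) = chart_map d p.
  by rewrite /chart_trans chart_expr_map.
have chain := chain_rule_coord (e i) cdE (chart_trans_differentiable cp dp)
  (chart_trans_differentiable dp d'p).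
have : 'D_(e i) (chart_trans c d') (chart_map c p) =
    'D_(e i) (chart_trans d d' \o chart_trans c d) (chart_map c p).
  apply: near_eq_derive.
  have oU := openI (mfd_dom_open hM d) (mfd_dom_open hM d').
  have := near_chart oU cp (conj dp d'p).
  apply: filterS => _ [q [cq [dq d'q]] <-].
  by rewrite /= /chart_trans !chart_expr_map.
rewrite chain => /matrixP /(_ 0 a) transE.
rewrite -[RHS]/('D_(e i) (chart_trans c d') (chart_map c p) 0 a) transE summxE.
apply: eq_bigr => k _; by rewrite [RHS]mxE [X in X * _]mxE [X in _ * X]mxE mulrC.
Qed.

Lemma jacobian_mx_refl c p : chart_dom c p -> jacobian_mx c c (chart_map c p) = 1%:M.
Proof.
move=> cp; apply/matrixP => a i; rewrite !mxE /chart_jac.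
have -> : 'D_(e i) (chart_trans c c) (chart_map c p) = 'D_(e i) id (chart_map c p).
  apply: near_eq_derive; have := near_chart openT cp I.
  by apply: filterS => _ [q [cq _] <-]; rewrite /chart_trans chart_expr_map.
by rewrite derive_id mxE eqxx.
Qed.

(** The component in one chart forces the components in the others by the
    transformation law, and the cocycle identity makes these consistent. *)
Lemma T11_of_component (c : chart A) p (m : 'M[R]_n) : chart_dom c p ->
  exists2 t : T11 A, tbase t = p & tcomp t c = m.
Proof.
move=> cp.
pose comp d := if pselect (chart_dom d p) then
  jacobian_mx c d (chart_map c p) *m m *m jacobian_mx d c (chart_map d p) else 0.
have compE d : chart_dom d p -> comp d =
  jacobian_mx c d (chart_map c p) *m m *m jacobian_mx d c (chart_map d p).
  by move=> dp; rewrite /comp; case: pselect.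
have comp_law (d d' : chart A) : chart_dom d p -> chart_dom d' p -> forall a b,
    comp d' a b = \sum_(i < n) \sum_(j < n)
      chart_jac d d' (chart_map d p) a i * chart_jac d' d (chart_map d' p) j b
      * comp d i j.
  move=> dp d'p a b.
  have -> : comp d' = jacobian_mx d d' (chart_map d p) *m comp d
      *m jacobian_mx d' d (chart_map d' p).
    rewrite (compE d' d'p) (compE d dp) -(jacobian_mx_cocycle cp dp d'p).
    by rewrite -(jacobian_mx_cocycle d'p dp cp) !mulmxA.
  rewrite mxE exchange_big; apply: eq_bigr => j _.
  rewrite mxE mulr_suml; apply: eq_bigr => i _; rewrite !mxE.
  by rewrite mulrAC.
have comp_out d : ~ chart_dom d p -> comp d = 0.
  by move=> ndp; rewrite /comp; case: pselect.
exists (@MkT11 _ _ _ A p comp comp_law comp_out) => //=.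
by rewrite compE // jacobian_mx_refl // mul1mx mulmx1.
Qed.

(** The axioms of a connection speak of open subsets of the chart image; this
    identification provides them. *)
Lemma T11_chart_im (c : chart A) :
  @chart_im _ _ (T11_atlas A) c = [set z | chart_im c z.1].
Proof.
apply/seteqP; split=> [_ [t ct <-]|[_ m] /= [p cp <-]]; first by exists (tbase t).
have [t tp tm] := T11_of_component m cp.
by exists t; rewrite /= ?tp ?tm.
Qed.

Lemma T11_chart_im_open (c : chart A) : open (@chart_im _ _ (T11_atlas A) c).
Proof.
rewrite T11_chart_im; apply: (@open_comp _ _ fst).
  by move=> z _; exact: cvg_fst.
exact: chart_im_open.
Qed.

End TensorCharts.

(** * Lifts and their brackets *)
Section Pairs.
Variables (R : realType) (E F F' : normedModType R).

Lemma continuous_fst : continuous (@fst E F).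
Proof. by move=> z; exact: cvg_fst. Qed.

Lemma continuous_snd : continuous (@snd E F).
Proof. by move=> z; exact: cvg_snd. Qed.

Lemma derive_pairE (X : F' -> E * F) v z : differentiable X z ->
  'D_v X z = ('D_v (fst \o X) z, 'D_v (snd \o X) z).
Proof.
move=> dX; rewrite (derive_comp_linear (L := fst) _ continuous_fst dX).
by rewrite (derive_comp_linear (L := snd) _ continuous_snd dX) -surjective_pairing.
Qed.

Lemma smooth_on_pairr (U : set F') (X : F' -> F) : open U -> smooth_on U X ->
  smooth_on U (fun z => (0 : E, X z)).
Proof.
move=> oU sX.
have lin : linear (fun w : F => (0 : E, w)).
  move=> a x y; rewrite -[RHS]/(a *: 0 + 0, a *: x + y).
  by rewrite scaler0 addr0.
pose LM := GRing.isLinear.Build _ _ _ _ _ lin.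
pose L : {linear _ -> _} := HB.pack (fun w : F => (0 : E, w)) LM.
apply: (@smooth_on_comp_linear _ _ _ _ U L) => //.
by move=> z; apply: cvg_pair => //; exact: cvg_cst.
Qed.

End Pairs.

Section Lifts.
Variables (R : realType) (n : nat) (M : topologicalType) (A : atlas M 'rV[R]_n).
Hypothesis hM : smooth_manifold A.
Variable g : chart A -> 'rV[R]_n -> 'rV[R]_n -> 'rV[R]_n -> R.
Variable D : chart A -> ('rV[R]_n -> 'rV[R]_n) -> ('rV[R]_n -> 'rV[R]_n) ->
  'rV[R]_n -> 'rV[R]_n.
Hypothesis hD : levi_civita g D.
Variable c : chart A.

Local Notation E := 'rV[R]_n.
Local Notation F := ('rV[R]_n * 'M[R]_n)%type.
Local Notation e := (basis_vec R).
Local Notation W := (chart_im c).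
Local Notation U := (@chart_im _ _ (T11_atlas A) c).
Local Notation Gm := (christoffel_mx D c).
Local Notation Rm := (curvature_mx D c).

Let oW : open W := @chart_im_open _ _ _ _ hM c.
Let oU : open U := @T11_chart_im_open _ _ _ _ hM c.

Lemma T11_chart_base z : U z -> W z.1.
Proof. by rewrite T11_chart_im. Qed.

Lemma sum_basis_vec k (h : 'I_n -> R) : \sum_s e k 0 s * h s = h k.
Proof.
rewrite (bigD1 k) //= big1 => [|s sk]; first by rewrite !mxE !eqxx mul1r addr0.
by rewrite !mxE (negPf sk) andbF mul0r.
Qed.

(** The sum over s reduces to the term s = k, whose two halves are the two
    products in the commutator of t and Gam_k. *)
Lemma EhorE k z : Ehor D c k z = (e k, mx_comm z.2 (Gm k z.1)).
Proof.
rewrite /Ehor /hlift /mx_comm; congr pair; apply/matrixP => i j.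
rewrite mxE sum_basis_vec [RHS]mxE; congr (_ + _); last rewrite [RHS]mxE.
  by rewrite mxE; apply: eq_bigr => m _; rewrite !mxE mulrC.
by rewrite mxE; congr (- _); apply: eq_bigr => m _; rewrite !mxE.
Qed.

Definition vertical (B : 'M[R]_n) : F -> F := fun=> (0, B).

Lemma smooth_vertical B : smooth_on U (vertical B).
Proof. exact: smooth_on_cst. Qed.

Lemma smooth_comp_fst (F' : normedModType R) (h : E -> F') :
  smooth_on W h -> smooth_on U (fun z => h z.1).
Proof.
move=> sh; rewrite T11_chart_im //.
exact: (smooth_on_precomp_linear (L := fst) oW (@continuous_fst _ _ _) sh).
Qed.

Let horizontal_part k (z : F) := mx_comm z.2 (Gm k z.1).

Lemma smooth_snd : smooth_on U (snd : F -> 'M[R]_n).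
Proof. exact: (@smooth_on_linear _ _ _ U snd (@continuous_snd _ _ _)). Qed.

Lemma smooth_horizontal_part k : smooth_on U (horizontal_part k).
Proof.
have sG := smooth_comp_fst (smooth_christoffel_mx hM hD (c := c) k).
apply: smooth_on_matrix => // i j.
apply: (@smooth_on_eq _ _ _ _ oU (fun z : F =>
  (z.2 *m Gm k z.1) i j + - (Gm k z.1 *m z.2) i j)).
  by move=> z _; rewrite /horizontal_part /mx_comm [RHS]mxE [X in _ = _ + X]mxE.
apply: smooth_on_add => //; last apply: smooth_on_opp => //.
  by apply: smooth_on_entry => //; apply: smooth_on_mulmx => //; exact: smooth_snd.
by apply: smooth_on_entry => //; apply: smooth_on_mulmx => //; exact: smooth_snd.
Qed.

Lemma smooth_Ehor k : smooth_on U (Ehor D c k).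
Proof.
apply: (@smooth_on_eq _ _ _ _ oU
  (fun z => (e k, 0) + (0, horizontal_part k z) : F)).
  move=> z _; rewrite EhorE.
  by rewrite -[LHS]/(e k + 0, 0 + horizontal_part k z) addr0 add0r.
apply: smooth_on_add => //; first exact: smooth_on_cst.
by apply: smooth_on_pairr => //; exact: smooth_horizontal_part.
Qed.

Lemma derive_comp_fst (F' : normedModType R) (h : E -> F') v z : W z.1 ->
  smooth_on W h -> 'D_v (fun z : F => h z.1) z = 'D_(v.1) h z.1.
Proof.
move=> Wz sh.
exact: (derive_precomp_linear (L := fst) v (@continuous_fst _ _ _)
  (smooth_on_differentiable sh Wz)).
Qed.

Lemma derive_snd v z : 'D_v (snd : F -> 'M[R]_n) z = v.2.
Proof.
have dL : differentiable (snd : F -> 'M[R]_n) z.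
  exact: (linear_differentiable (f := snd) z (@continuous_snd _ _ _)).
by rewrite deriveE // (diff_lin (f := snd) z (@continuous_snd _ _ _)).
Qed.

Lemma derive_horizontal_part k v z : U z ->
  'D_v (horizontal_part k) z =
  mx_comm v.2 (Gm k z.1) + mx_comm z.2 ('D_(v.1) (Gm k) z.1).
Proof.
move=> Uz; have Wz := T11_chart_base Uz.
have sG := smooth_christoffel_mx hM hD (c := c) k.
have dG : derivable (fun z : F => Gm k z.1) z v.
  exact: smooth_on_derivable (smooth_comp_fst sG) Uz.
have ds : derivable (snd : F -> 'M[R]_n) z v := smooth_on_derivable smooth_snd Uz.
have GE := derive_comp_fst v Wz sG.
have := deriveB (derivable_mulmx ds dG) (derivable_mulmx dG ds).
rewrite (derive_mulmx ds dG) (derive_mulmx dG ds) GE derive_snd => {GE} DE.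
apply: etrans DE _; rewrite /mx_comm; move: ('D_(v.1) (Gm k) z.1) => DG.
by rewrite [DG *m _ + _]addrC opprD addrACA.
Qed.

Lemma derive_Ehor k v z : U z ->
  'D_v (Ehor D c k) z =
  (0, mx_comm v.2 (Gm k z.1) + mx_comm z.2 ('D_(v.1) (Gm k) z.1)).
Proof.
move=> Uz; rewrite (derive_pairE _ (smooth_on_differentiable (smooth_Ehor k) Uz)).
congr pair.
  have -> : fst \o Ehor D c k = cst (e k) by apply/funext => w; rewrite /comp EhorE.
  exact: derive_cst.
have -> : snd \o Ehor D c k = horizontal_part k.
  by apply/funext => w; rewrite /comp EhorE.
exact: derive_horizontal_part.
Qed.

Lemma lie_bracket_anti (E' : normedModType R) (X Y : E' -> E') y :
  lie_bracket Y X y = - lie_bracket X Y y.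
Proof. by rewrite /lie_bracket opprB. Qed.

Lemma bracket_vertical B C z : lie_bracket (vertical B) (vertical C) z = 0.
Proof. by rewrite /lie_bracket !derive_cst subr0. Qed.

Lemma bracket_hor_vert k B z : U z ->
  lie_bracket (Ehor D c k) (vertical B) z = (0, mx_comm (Gm k z.1) B).
Proof.
move=> Uz; rewrite /lie_bracket derive_cst (derive_Ehor k _ Uz) /= derive0.
rewrite /mx_comm mulmx0 mul0mx subr0 addr0 sub0r.
by congr pair; rewrite ?oppr0 // opprB.
Qed.

(** By the Jacobi identity, [[t, Gam_k], Gam_l] - [[t, Gam_l], Gam_k] is
    [t, [Gam_k, Gam_l]], which completes the terms with derivatives of the
    connection matrices to [t, R_kl]. *)
Lemma bracket_hor_hor k l z : U z ->
  lie_bracket (Ehor D c k) (Ehor D c l) z = (0, mx_comm z.2 (Rm k l z.1)).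
Proof.
move=> Uz; rewrite /lie_bracket (derive_Ehor k _ Uz) (derive_Ehor l _ Uz) !EhorE /=.
rewrite -[LHS]/(0 - 0, _ - _) subr0; congr pair.
rewrite /mx_comm /curvature_mx.
move: ('D_(e k) _ _) ('D_(e l) _ _) (Gm k z.1) (Gm l z.1) z.2 => a b p q t.
rewrite !(mulmxDl, mulmxDr, mulNmx, mulmxN) !mulmxA.
move: (t *m p *m q) (p *m t *m q) (q *m t *m p) (q *m p *m t) (t *m a) (a *m t)
  (t *m q *m p) (p *m q *m t) (t *m b) (b *m t) => t1 t2 t3 t4 t5 t6 t7 t8 t9 t10.
by apply/matrixP => i j; rewrite !mxE; ring.
Qed.

End Lifts.

(** * The connection of the rescaled metric in the adapted frame *)
Section Sasaki.
Variables (R : realType) (n : nat) (M : topologicalType) (A : atlas M 'rV[R]_n).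
Hypothesis hM : smooth_manifold A.
Variable g : chart A -> 'rV[R]_n -> 'rV[R]_n -> 'rV[R]_n -> R.
Hypothesis hg : riemannian_metric g.
Variable D : chart A -> ('rV[R]_n -> 'rV[R]_n) -> ('rV[R]_n -> 'rV[R]_n) ->
  'rV[R]_n -> 'rV[R]_n.
Hypothesis hD : levi_civita g D.
Variables (f : M -> R) (hf : smooth_fun A f) (f_gt0 : forall p : M, 0 < f p).
Variable G : chart (T11_atlas A) -> 'rV[R]_n * 'M[R]_n -> 'rV[R]_n * 'M[R]_n ->
         'rV[R]_n * 'M[R]_n -> R.
Hypothesis hG : rescaled_sasaki g D f G.
Variable Dt : chart (T11_atlas A) ->
          ('rV[R]_n * 'M[R]_n -> 'rV[R]_n * 'M[R]_n) ->
          ('rV[R]_n * 'M[R]_n -> 'rV[R]_n * 'M[R]_n) ->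
          'rV[R]_n * 'M[R]_n -> 'rV[R]_n * 'M[R]_n.
Hypothesis hDt : levi_civita G Dt.
Variable c : chart A.

Local Notation E := 'rV[R]_n.
Local Notation F := ('rV[R]_n * 'M[R]_n)%type.
Local Notation e := (basis_vec R).
Local Notation W := (chart_im c).
Local Notation U := (@chart_im _ _ (T11_atlas A) c).
Local Notation Gm := (christoffel_mx D c).
Local Notation Gam := (christoffel D c).
Local Notation Rm := (curvature_mx D c).
Local Notation gm := (gram g c).
Local Notation gi := (gram_inv g c).
Local Notation gl := (glow g c).
Local Notation fe := (chart_expr c f).
Local Notation hor := (Ehor D c).

Let oW : open W := @chart_im_open _ _ _ _ hM c.
Let oU : open U := @T11_chart_im_open _ _ _ _ hM c.
Let Wc : W `<=` W := @subset_refl _ W.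
Let Uc : U `<=` U := @subset_refl _ U.
Let hGm := rs_metric hG.
Let baseW z : U z -> W z.1 := @T11_chart_base _ _ _ _ hM c z.

Let sgm : smooth_on W gm. Proof. exact: smooth_gram. Qed.
Let sgi : smooth_on W gi. Proof. exact: smooth_gram_inv. Qed.

(** The metric g_ik g^jl B_j^i C_l^k induced by g on (1,1)-tensors, as a trace. *)
Definition fibre_metric (y : E) (B C : 'M[R]_n) : R :=
  \tr (B^T *m gm y *m C *m gi y).

Lemma fibre_metricE y B C : W y -> fibre_metric y B C =
  \sum_(i < n) \sum_(k < n) \sum_(j < n) \sum_(l < n)
    gl y i k * gup g c y j l * B i j * C k l.
Proof.
move=> Wy; symmetry.
under eq_bigr => i _ do rewrite exchange_big /=.
rewrite exchange_big; apply: eq_bigr => j _ /=.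
under eq_bigr => i _ do rewrite exchange_big /=.
rewrite exchange_big [RHS]mxE; apply: eq_bigr => l _ /=.
rewrite exchange_big mxE mulr_suml; apply: eq_bigr => k _ /=.
rewrite mxE !mulr_suml; apply: eq_bigr => i _.
rewrite [B^T j i]mxE [gm y i k]mxE.
have -> : gup g c y j l = gi y l j by rewrite -(gram_inv_sym hg Wy) mxE.
by ring.
Qed.

Lemma fibre_metric_sym y B C : W y -> fibre_metric y B C = fibre_metric y C B.
Proof.
move=> Wy; rewrite /fibre_metric -mxtrace_tr !trmx_mul trmxK.
by rewrite (gram_sym hg Wy) (gram_inv_sym hg Wy) -!mulmxA mxtrace_mulC !mulmxA.
Qed.

Lemma fibre_metric_delta y B i j : W y ->
  fibre_metric y B (delta_mx i j) = (gm y *m B *m gi y) i j.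
Proof.
move=> Wy; rewrite /fibre_metric mxtrace_mulC !mulmxA.
have -> : gi y *m B^T *m gm y = (gm y *m B *m gi y)^T.
  by rewrite !trmx_mul (gram_sym hg Wy) (gram_inv_sym hg Wy) mulmxA.
move: (gm y *m B *m gi y) => N.
rewrite /mxtrace (bigD1 j) //= big1 => [|k kj].
  rewrite addr0 mxE (bigD1 i) //= big1 => [|k ki].
    by rewrite !mxE !eqxx mulr1 addr0.
  by rewrite !mxE (negPf ki) mulr0.
by rewrite mxE big1 // => m _; rewrite !mxE (negPf kj) andbF mulr0.
Qed.

(** The fibre metric is parallel: the derivatives of g and of g^-1 regroup into
    the two commutators, because the trace is cyclic. *)
Lemma derive_fibre_metric y k B C : W y ->
  'D_(e k) (fun y => fibre_metric y B C) y =
  fibre_metric y (mx_comm (Gm k y) B) C + fibre_metric y B (mx_comm (Gm k y) C).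
Proof.
move=> Wy.
have dg : derivable gm y (e k) by exact: smooth_on_derivable sgm Wy.
have di : derivable gi y (e k) by exact: smooth_on_derivable sgi Wy.
have dgC := derivable_mulmxr (C := C) dg.
have dBgC := derivable_mulmxl (B := B^T) dgC.
have -> : (fun y => fibre_metric y B C) =
    (fun y => \tr (B^T *m (gm y *m C) *m gi y)).
  by apply/funext => z; rewrite /fibre_metric !mulmxA.
have DP := derive_mulmx dBgC di.
rewrite (derive_mulmxl B^T dgC) (derive_mulmxr C dg) in DP.
rewrite (derive_gram hM hg hD k Wy) (derive_gram_inv hM hg hD k Wy) in DP.
apply: etrans (derive_mxtrace (derivable_mulmx dBgC di)) _.
rewrite DP /fibre_metric /mx_comm.
move: (gm y) (gi y) (Gm k y) => a b p.
have -> : (p *m B - B *m p)^T = B^T *m p^T - p^T *m B^T.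
  by rewrite linearB /= !trmx_mul.
rewrite !(mulmxDl, mulmxDr, mulNmx, mulmxN) !mulmxA.
rewrite !(mxtraceD, raddfN) /= !mxtraceD.
have -> : \tr (B^T *m a *m C *m b *m p^T) = \tr (p^T *m B^T *m a *m C *m b).
  by rewrite mxtrace_mulC !mulmxA.
ring.
Qed.

Lemma T11_chartP z : U z -> exists t : T11 A,
  [/\ chart_dom c (tbase t), W (chart_map c (tbase t)) &
      z = (chart_map c (tbase t), tcomp t c)].
Proof. by case=> t ct <-; exists t; split=> //; exists (tbase t). Qed.

Lemma sasaki_vv z B C : U z -> G c z (0, B) (0, C) = fibre_metric z.1 B C.
Proof.
move=> Uz; rewrite fibre_metricE; last exact: baseW.
have [t [ct Wt ->]] := T11_chartP Uz.
by apply: (rs_vv hG oW Wc (smooth_on_cst oW B) (smooth_on_cst oW C) ct Wt).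
Qed.

Lemma sasaki_vh z B k : U z -> G c z (0, B) (hor k z) = 0.
Proof.
move=> Uz; have [t [ct Wt ->]] := T11_chartP Uz.
exact: (rs_vh hG oW Wc (smooth_on_cst oW B) (smooth_coord_field k oW) ct Wt).
Qed.

Lemma sasaki_hh z k l : U z -> G c z (hor k z) (hor l z) = fe z.1 * gl z.1 k l.
Proof.
move=> Uz; have [t [ct Wt ->]] := T11_chartP Uz.
rewrite /= (chart_expr_map hM _ ct).
exact: (rs_hh hG oW Wc (smooth_coord_field k oW) (smooth_coord_field l oW) ct Wt).
Qed.

Lemma chart_expr_gt0 y : W y -> 0 < fe y.
Proof. by move=> [p cp <-]; rewrite (chart_expr_map hM _ cp). Qed.

Lemma sum_Ever z (B : 'M[R]_n) :
  \sum_v \sum_r B v r *: @Ever R n v r z = (0, B).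
Proof.
have lin : linear (fun C : 'M[R]_n => (0 : E, C)).
  by move=> b x y; rewrite -[RHS]/(b *: 0 + 0, b *: x + y) scaler0 addr0.
pose LM := GRing.isLinear.Build _ _ _ _ _ lin.
pose L : {linear _ -> _} := HB.pack (fun C : 'M[R]_n => (0 : E, C)) LM.
rewrite -[RHS]/(L B) [in RHS](matrix_sum_delta B) linear_sum.
apply: eq_bigr => v _; rewrite linear_sum; apply: eq_bigr => r _.
by rewrite linearZ.
Qed.

(** The difference of the two sides is orthogonal to the frame; as the frame
    spans, it is orthogonal to itself. *)
Lemma frame_decomposition z u (a : 'I_n -> R) (B : 'M[R]_n) : U z ->
  (forall k, G c z u (hor k z) = fe z.1 * \sum_r a r * gl z.1 r k) ->
  (forall C, G c z u (0, C) = fibre_metric z.1 B C) ->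
  u = \sum_r a r *: hor r z + (0, B).
Proof.
move=> Uz uh uv.
set w := _ + _; apply/eqP; rewrite -subr_eq0; set d := u - w.
have wh k : G c z w (hor k z) = fe z.1 * \sum_r a r * gl z.1 r k.
  rewrite (metric_addl hGm) // (sasaki_vh _ _ Uz) addr0 (metric_suml hGm) // mulr_sumr.
  by apply: eq_bigr => r _; rewrite (metric_scalel hGm) // sasaki_hh // mulrCA.
have wv C : G c z w (0, C) = fibre_metric z.1 B C.
  rewrite (metric_addl hGm) // (sasaki_vv _ _ Uz) (metric_suml hGm) // big1 ?add0r //.
  move=> r _; rewrite (metric_scalel hGm) // (rm_sym hGm _ _ Uz).
  by rewrite (sasaki_vh _ _ Uz) mulr0.
have dh k : G c z d (hor k z) = 0 by rewrite (metric_subl hGm) // uh wh subrr.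
have dv C : G c z d (0, C) = 0 by rewrite (metric_subl hGm) // uv wv subrr.
have dE : d = \sum_k d.1 0 k *: hor k z + (0, d.2 - (\sum_k d.1 0 k *: hor k z).2).
  have sum1 : (\sum_k d.1 0 k *: hor k z).1 = d.1.
    rewrite [RHS]row_sum_delta -[LHS]/(fst _) raddf_sum /=.
    by apply: eq_bigr => k _.
  rewrite [LHS]surjective_pairing -[RHS]/(_ + 0, _ + (_ - _)).
  by rewrite addr0 subrKC sum1.
apply/negPn/negP => d0; have := rm_pos hGm Uz d0.
rewrite {1}dE (metric_addl hGm) // (rm_sym hGm (0, _) _ Uz) dv addr0.
rewrite (metric_suml hGm) // big1 ?ltxx // => k _.
by rewrite (metric_scalel hGm) // (rm_sym hGm _ _ Uz) dh mulr0.
Qed.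

Lemma smooth_fibre_metric B C : smooth_on W (fun y => fibre_metric y B C).
Proof.
apply: smooth_on_sum => // i; apply: smooth_on_entry => //.
apply: (smooth_on_mulmx oW _ sgi).
apply: smooth_on_mulmx => //; last exact: smooth_on_cst.
exact: (smooth_on_mulmx oW (smooth_on_cst oW _) sgm).
Qed.

Lemma smooth_scaled_glow i j : smooth_on W (fun y => fe y * gl y i j).
Proof. by apply: smooth_on_mul => //; exact: (smooth_glow hg). Qed.

Lemma derive_sasaki_vv (v : F) B C z : U z ->
  'D_v (fun w => G c w (vertical B w) (vertical C w)) z =
  'D_(v.1) (fun y => fibre_metric y B C) z.1.
Proof.
move=> Uz; rewrite -(derive_comp_fst v (baseW Uz) (smooth_fibre_metric B C)).
by apply: (derive_eq_on oU) Uz => w Uw; exact: sasaki_vv.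
Qed.

Lemma derive_sasaki_vh (v : F) B k z : U z ->
  'D_v (fun w => G c w (vertical B w) (hor k w)) z = 0.
Proof.
move=> Uz; rewrite -(derive_cst (0 : R) z v).
by apply: (derive_eq_on oU) Uz => w Uw; exact: sasaki_vh.
Qed.

Lemma derive_sasaki_hv (v : F) B k z : U z ->
  'D_v (fun w => G c w (hor k w) (vertical B w)) z = 0.
Proof.
move=> Uz; rewrite -(derive_sasaki_vh v B k Uz).
by apply: (derive_eq_on oU) Uz => w Uw; exact: (rm_sym hGm _ _ Uw).
Qed.

Lemma derive_sasaki_hh (v : F) k l z : U z ->
  'D_v (fun w => G c w (hor k w) (hor l w)) z =
  'D_(v.1) (fun y => fe y * gl y k l) z.1.
Proof.
move=> Uz; rewrite -(derive_comp_fst v (baseW Uz) (smooth_scaled_glow k l)).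
by apply: (derive_eq_on oU) Uz => w Uw; exact: sasaki_hh.
Qed.

Let sh k : smooth_on U (hor k) := @smooth_Ehor _ _ _ _ hM _ _ hD c k.
Let sv B : smooth_on U (vertical B) := @smooth_vertical _ _ _ _ hM c B.

Lemma bracket_vert_hor k B z : U z ->
  lie_bracket (vertical B) (hor k) z = (0, - mx_comm (Gm k z.1) B).
Proof.
move=> Uz; rewrite lie_bracket_anti (bracket_hor_vert hM hD _ _ Uz).
by rewrite -[LHS]/(-0, - _) oppr0.
Qed.

Lemma fibre_metricZl y a B C : fibre_metric y (a *: B) C = a * fibre_metric y B C.
Proof. by rewrite /fibre_metric linearZ /= -!scalemxAl linearZ. Qed.

Lemma fibre_metric0l y C : fibre_metric y 0 C = 0.
Proof. by rewrite -(scale0r (0 : 'M[R]_n)) fibre_metricZl mul0r. Qed.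

Lemma fibre_metricNl y B C : fibre_metric y (- B) C = - fibre_metric y B C.
Proof. by rewrite -scaleN1r fibre_metricZl mulN1r. Qed.

(** The products of horizontal with vertical fields vanish and f g is constant
    along the fibres, so only the bracket of the horizontal fields survives. *)
Lemma cov_hor_hor_vert l j C z : U z ->
  2 * G c z (Dt c (hor l) (hor j) z) (0, C) =
  fibre_metric z.1 (mx_comm z.2 (Rm l j z.1)) C.
Proof.
move=> Uz; have := koszul hGm hDt oU Uc (sh l) (sh j) (sv C) Uz.
rewrite -[vertical C z]/(0, C) => ->.
rewrite (derive_sasaki_hv (hor l z) C j Uz) (derive_sasaki_hv (hor j z) C l Uz).
rewrite (derive_sasaki_hh (0, C) l j Uz) derive0.
rewrite (bracket_hor_hor hM hD _ _ Uz) (bracket_hor_vert hM hD _ _ Uz).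
rewrite (bracket_hor_vert hM hD _ _ Uz) !(sasaki_vh _ _ Uz).
by rewrite (sasaki_vv _ _ Uz) !subr0 !add0r.
Qed.

(** The brackets are vertical, so only the derivatives of f g survive. *)
Lemma cov_hor_hor_hor l j k z : U z ->
  2 * G c z (Dt c (hor l) (hor j) z) (hor k z) =
  'D_(e l) (fun y => fe y * gl y j k) z.1 + 'D_(e j) (fun y => fe y * gl y l k) z.1
  - 'D_(e k) (fun y => fe y * gl y l j) z.1.
Proof.
move=> Uz; have := koszul hGm hDt oU Uc (sh l) (sh j) (sh k) Uz => ->.
rewrite (derive_sasaki_hh (hor l z) j k Uz) (derive_sasaki_hh (hor j z) l k Uz).
rewrite (derive_sasaki_hh (hor k z) l j Uz).
rewrite (bracket_hor_hor hM hD l j Uz) (bracket_hor_hor hM hD l k Uz).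
rewrite (bracket_hor_hor hM hD j k Uz) !(sasaki_vh _ _ Uz).
by rewrite !subr0 addr0.
Qed.

(** Of the three brackets, only that of the horizontal fields is paired with a
    vertical field. *)
Lemma cov_hor_vert_hor l B k z : U z ->
  2 * G c z (Dt c (hor l) (vertical B) z) (hor k z) =
  - fibre_metric z.1 (mx_comm z.2 (Rm l k z.1)) B.
Proof.
move=> Uz; have := koszul hGm hDt oU Uc (sh l) (sv B) (sh k) Uz => ->.
rewrite (derive_sasaki_vh (hor l z) B k Uz) (derive_sasaki_hh (vertical B z) l k Uz).
rewrite derive0 (derive_sasaki_hv (hor k z) B l Uz).
rewrite (bracket_vert_hor k B Uz) (bracket_hor_vert hM hD l B Uz).
rewrite (bracket_hor_hor hM hD l k Uz).
rewrite !(sasaki_vh _ _ Uz) (sasaki_vv _ _ Uz).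
by rewrite !subr0 !add0r.
Qed.

(** By parallelism the derivative of the fibre metric splits into two products;
    one of them cancels a bracket and the other one equals the remaining one. *)
Lemma cov_hor_vert_vert l B C z : U z ->
  2 * G c z (Dt c (hor l) (vertical B) z) (0, C) =
  2 * fibre_metric z.1 (mx_comm (Gm l z.1) B) C.
Proof.
move=> Uz; have := koszul hGm hDt oU Uc (sh l) (sv B) (sv C) Uz.
rewrite -[vertical C z]/(0, C) => ->.
rewrite (derive_sasaki_vv (hor l z) B C Uz) (derive_sasaki_hv (vertical B z) C l Uz).
rewrite (derive_sasaki_hv (0, C) B l Uz) (derive_fibre_metric l B C (baseW Uz)).
rewrite bracket_vertical (metric0l hGm) // !(bracket_hor_vert hM hD _ _ Uz).
rewrite !(sasaki_vv _ _ Uz).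
rewrite (fibre_metric_sym B (mx_comm (Gm l z.1) C) (baseW Uz)).
ring.
Qed.

(** By parallelism the derivative of the fibre metric along the horizontal field
    cancels the two brackets. *)
Lemma cov_vert_vert_hor B C k z : U z ->
  2 * G c z (Dt c (vertical B) (vertical C) z) (hor k z) = 0.
Proof.
move=> Uz; have := koszul hGm hDt oU Uc (sv B) (sv C) (sh k) Uz => ->.
rewrite (derive_sasaki_vh (vertical B z) C k Uz).
rewrite (derive_sasaki_vh (vertical C z) B k Uz).
rewrite (derive_sasaki_vv (hor k z) B C Uz) (derive_fibre_metric k B C (baseW Uz)).
rewrite bracket_vertical (metric0l hGm) //.
rewrite (bracket_vert_hor k B Uz) (bracket_vert_hor k C Uz).
rewrite !(sasaki_vv _ _ Uz) !fibre_metricNl.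
rewrite (fibre_metric_sym (mx_comm _ C) _ (baseW Uz)).
ring.
Qed.

Lemma cov_vert_vert_vert B C C' z : U z ->
  2 * G c z (Dt c (vertical B) (vertical C) z) (0, C') = 0.
Proof.
move=> Uz; have := koszul hGm hDt oU Uc (sv B) (sv C) (sv C') Uz.
rewrite -[vertical C' z]/(0, C') => ->.
rewrite (derive_sasaki_vv (vertical B z) C C' Uz).
rewrite (derive_sasaki_vv (vertical C z) B C' Uz).
rewrite (derive_sasaki_vv (0, C') B C Uz) !derive0 !bracket_vertical !(metric0l hGm) //.
by rewrite !subr0 !addr0.
Qed.

Let fe_neq0 z : U z -> fe z.1 != 0.
Proof. by move=> Uz; rewrite gt_eqF // (chart_expr_gt0 (baseW Uz)). Qed.

Let two_neq0 : (2 : R) != 0. Proof. by []. Qed.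

Lemma nabla_hor_hor l j z : U z ->
  Dt c (hor l) (hor j) z =
  \sum_r (Gam z.1 l j r + (2 * fe z.1)^-1 * fA g f c z.1 l j r) *: hor r z
  + (0, 2^-1 *: mx_comm z.2 (Rm l j z.1)).
Proof.
move=> Uz; apply: (frame_decomposition Uz) => [k|C].
  apply: (mulfI two_neq0); rewrite (cov_hor_hor_hor l j k Uz).
  exact: (scaled_koszul hM hg hD hf l j k (baseW Uz) (fe_neq0 Uz)).
apply: (mulfI two_neq0); rewrite (cov_hor_hor_vert l j C Uz).
by rewrite fibre_metricZl mulVKf.
Qed.

Lemma nabla_hor_vert l i j z : U z ->
  Dt c (hor l) (vertical (delta_mx i j)) z =
  \sum_r ((2 * fe z.1)^-1 *
       (\sum_(a < n) \sum_(s < n) gl z.1 i a * riem_up g D c z.1 s j l r * z.2 a s)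
     - (2 * fe z.1)^-1 *
       (\sum_(b < n) \sum_(s < n) gup g c z.1 j b * riem D c z.1 i s l r * z.2 s b))
    *: hor r z
  + (0, mx_comm (Gm l z.1) (delta_mx i j)).
Proof.
move=> Uz; apply: (frame_decomposition Uz) => [k|C].
  apply: (mulfI two_neq0); rewrite (cov_hor_vert_hor l _ k Uz).
  rewrite (fibre_metric_delta _ _ _ (baseW Uz)).
  exact/esym/(lower_mixed hM hg hD z.2 i j l k (baseW Uz) (fe_neq0 Uz)).
by apply: (mulfI two_neq0); rewrite (cov_hor_vert_vert l _ C Uz).
Qed.

(** The torsion vanishes. *)
Lemma nabla_vert_hor B j z : U z ->
  Dt c (vertical B) (hor j) z =
  Dt c (hor j) (vertical B) z - (0, mx_comm (Gm j z.1) B).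
Proof.
move=> Uz; have := lc_torsion_free hDt oU Uc (sh j) (sv B) Uz.
rewrite (bracket_hor_vert hM hD _ _ Uz) => <-.
by rewrite opprB addrC subrK.
Qed.

Lemma nabla_vert_vert B C z : U z -> Dt c (vertical B) (vertical C) z = 0.
Proof.
move=> Uz; set u := Dt c _ _ z.
rewrite (@frame_decomposition z u (fun=> 0) 0 Uz).
- by rewrite big1 ?add0r // => r _; rewrite scale0r.
- move=> k; rewrite big1 ?mulr0 => [|r _]; last exact: mul0r.
  by apply: (mulfI two_neq0); rewrite (cov_vert_vert_hor B C k Uz) mulr0.
move=> C'; rewrite fibre_metric0l.
by apply: (mulfI two_neq0); rewrite (cov_vert_vert_vert B C C' Uz) mulr0.
Qed.

End Sasaki.

Theorem theorem1 (R : realType) (n : nat) (M : topologicalType)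
    (A : atlas M 'rV[R]_n) (hM : smooth_manifold A)
    (g : chart A -> 'rV[R]_n -> 'rV[R]_n -> 'rV[R]_n -> R)
    (hg : riemannian_metric g)
    (D : chart A -> ('rV[R]_n -> 'rV[R]_n) -> ('rV[R]_n -> 'rV[R]_n) ->
         'rV[R]_n -> 'rV[R]_n)
    (hD : levi_civita g D)
    (f : M -> R) (hf : smooth_fun A f) (f_gt0 : forall p : M, 0 < f p)
    (G : chart (T11_atlas A) -> 'rV[R]_n * 'M[R]_n -> 'rV[R]_n * 'M[R]_n ->
         'rV[R]_n * 'M[R]_n -> R)
    (hG : rescaled_sasaki g D f G)
    (Dt : chart (T11_atlas A) ->
          ('rV[R]_n * 'M[R]_n -> 'rV[R]_n * 'M[R]_n) ->
          ('rV[R]_n * 'M[R]_n -> 'rV[R]_n * 'M[R]_n) ->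
          'rV[R]_n * 'M[R]_n -> 'rV[R]_n * 'M[R]_n)
    (hDt : levi_civita G Dt)
    (c : chart A) (p : T11 A) (hp : chart_dom c (tbase p)) :
  let x := chart_map c (tbase p) in
  let t := tcomp p c in
  let z := (x, t) in
  let fx := f (tbase p) in
  let gl := glow g c x in
  let gu := gup g c x in
  let Gam := christoffel D c x in
  let Rm := riem D c x in
  let Rup := riem_up g D c x in
  let E := Ehor D c in
  let Eb := @Ever R n in
  [/\ (* i *)
      forall l j : 'I_n,
        Dt c (E l) (E j) z =
          \sum_(r < n) (Gam l j r + (2 * fx)^-1 * fA g f c x l j r) *: E r z
          + \sum_(v < n) \sum_(r < n)
              (2^-1 * (\sum_(s < n) Rm l j r s * t v s)
               - 2^-1 * (\sum_(s < n) Rm l j s v * t s r)) *: Eb v r z,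
      (* ii *)
      forall l i j : 'I_n,
        Dt c (E l) (Eb i j) z =
          \sum_(r < n)
            ((2 * fx)^-1 *
               (\sum_(a < n) \sum_(s < n) gl i a * Rup s j l r * t a s)
             - (2 * fx)^-1 *
               (\sum_(b < n) \sum_(s < n) gu j b * Rm i s l r * t s b)) *: E r z
          + \sum_(v < n) \sum_(r < n)
              (Gam l i v * (j == r)%:R - Gam l r j * (i == v)%:R) *: Eb v r z,
      (* iii *)
      forall k l j : 'I_n,
        Dt c (Eb k l) (E j) z =
          \sum_(r < n)
            ((2 * fx)^-1 *
               (\sum_(a < n) \sum_(s < n) gl k a * Rup s l j r * t a s)
             - (2 * fx)^-1 *
               (\sum_(b < n) \sum_(s < n) gu l b * Rm k s j r * t s b)) *: E r z
    & (* iv *)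
      forall k l i j : 'I_n,
        Dt c (Eb k l) (Eb i j) z = 0].
Proof.
move=> x t z fx gl gu Gam Rm Rup E Eb.
have Uz : @chart_im _ _ (T11_atlas A) c z by exists p.
have Wx : chart_im c x by exists (tbase p).
have fxE : fx = chart_expr c f x by rewrite /x (chart_expr_map hM).
have nabla_hv l i j : Dt c (E l) (Eb i j) z =
    \sum_(r < n)
      ((2 * fx)^-1 * (\sum_(a < n) \sum_(s < n) gl i a * Rup s j l r * t a s)
       - (2 * fx)^-1 * (\sum_(b < n) \sum_(s < n) gu j b * Rm i s l r * t s b))
      *: E r z
    + (0, mx_comm (christoffel_mx D c l x) (delta_mx i j)).
  by rewrite fxE; exact: (nabla_hor_vert hM hg hD hf f_gt0 hG hDt l i j Uz).
split=> [l j|l i j|k l j|k l i j].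
- rewrite [LHS](nabla_hor_hor hM hg hD hf f_gt0 hG hDt l j Uz) -fxE.
  congr (_ + _); rewrite -(sum_Ever z); apply: eq_bigr => v _.
  apply: eq_bigr => r _; congr (_ *: _).
  rewrite mxE mx_commE mulrBr.
  congr (_ * _ - _ * _); apply: eq_bigr => s _.
    by rewrite /Rm (riemE hM hD _ _ _ _ Wx) mulrC.
  by rewrite /Rm (riemE hM hD _ _ _ _ Wx).
- rewrite nabla_hv; congr (_ + _); rewrite -(sum_Ever z).
  apply: eq_bigr => v _; apply: eq_bigr => r _; congr (_ *: _).
  rewrite mx_commE; congr (_ - _).
    rewrite (bigD1 i) //= big1 => [|m mi].
      by rewrite !mxE eqxx addr0 [r == j]eq_sym.
    by rewrite !mxE (negPf mi) mulr0.
  rewrite (bigD1 j) //= big1 => [|m mj].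
    by rewrite !mxE eqxx andbT addr0 mulrC [v == i]eq_sym.
  by rewrite !mxE (negPf mj) andbF mul0r.
(* The bracket cancels the vertical part of the previous formula. *)
- rewrite [LHS](nabla_vert_hor hM hD hDt (delta_mx k l) j Uz).
  by rewrite [X in X - _](nabla_hv j k l) addrK.
exact: (nabla_vert_vert hM hg hD hG hDt).
Qed.
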